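(* Let $X$ be a reflexive Banach space and $\varphi:X\to\mathbb{R}$ locally Lipschitz continuous satisfying the Cerami condition (C). Let $a\in\mathbb{R}$ and $a<b\le\infty$ be such that $K_a(\varphi)$ is finite and $K_c(\varphi)=\emptyset$ for all $c\in(a,b)$. Then there exists a continuous mapping $h:[0,1]\times(\overline\varphi^b\setminus K_b(\varphi))\to\overline\varphi^b\setminus K_b(\varphi)$ such that (i) $h(0,u)=u$ and $h(1,u)\in\overline\varphi^a$ for all $u\in\overline\varphi^b\setminus K_b(\varphi)$; (ii) $h(t,u)=u$ for all $(t,u)\in[0,1]\times\overline\varphi^a$; (iii) $\varphi(h(t,u))\le\varphi(u)$ for all $(t,u)\in[0,1]\times(\overline\varphi^b\setminus K_b(\varphi))$. In particular, $\overline\varphi^a$ is a strong deformation retract of $\overline\varphi^b\setminus K_b(\varphi)$.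
   Context: For locally Lipschitz $\varphi:X\to\mathbb{R}$: Clarke directional derivative $\varphi^\circ(u;v)=\limsup_{w\to u,\,t\to0^+}\frac{\varphi(w+tv)-\varphi(w)}{t}$; Clarke subdifferential $\partial\varphi(u)=\{u^*\in X^*:\langle u^*,v\rangle\le\varphi^\circ(u;v)\ \forall v\in X\}$ (nonempty, weakly* compact); $m(u)=\min_{u^*\in\partial\varphi(u)}\|u^*\|_*$. $u$ is a critical point if $m(u)=0$; $K(\varphi)$ is the set of critical points and $K_c(\varphi)=\{u\in K(\varphi):\varphi(u)=c\}$ (with $K_\infty(\varphi)=\emptyset$). $\varphi$ satisfies the Cerami condition (C) if every sequence $(u_n)$ with $(\varphi(u_n))$ bounded and $(1+\|u_n\|)m(u_n)\to0$ has a convergent subsequence. Sublevel sets: $\overline\varphi^c=\{u\in X:\varphi(u)\le c\}$, and $\overline\varphi^\infty=X$. *)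

(* Defs.v *)
From Stdlib Require Import Reals Lra List Classical ClassicalEpsilon.
Open Scope R_scope.

Record NormedSpace := {
  carrier :> Type;
  vadd : carrier -> carrier -> carrier;
  vscal : R -> carrier -> carrier;
  vzero : carrier;
  vnorm : carrier -> R;
  vadd_assoc : forall x y z, vadd x (vadd y z) = vadd (vadd x y) z;
  vadd_comm : forall x y, vadd x y = vadd y x;
  vadd_0 : forall x, vadd x vzero = x;
  vadd_opp : forall x, vadd x (vscal (-1) x) = vzero;
  vscal_assoc : forall a b x, vscal a (vscal b x) = vscal (a * b) x;
  vscal_1 : forall x, vscal 1 x = x;
  vscal_distr_v : forall a x y, vscal a (vadd x y) = vadd (vscal a x) (vscal a y);
  vscal_distr_s : forall a b x, vscal (a + b) x = vadd (vscal a x) (vscal b x);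
  vnorm_nonneg : forall x, 0 <= vnorm x;
  vnorm_eq0 : forall x, vnorm x = 0 -> x = vzero;
  vnorm_scal : forall a x, vnorm (vscal a x) = Rabs a * vnorm x;
  vnorm_triangle : forall x y, vnorm (vadd x y) <= vnorm x + vnorm y
}.

Arguments vadd {_}. Arguments vscal {_}. Arguments vzero {_}. Arguments vnorm {_}.

Definition vsub {X : NormedSpace} (x y : X) : X := vadd x (vscal (-1) y).

Definition complete (X : NormedSpace) : Prop :=
  forall u : nat -> X,
    (forall eps, eps > 0 -> exists N, forall n m, (n >= N)%nat -> (m >= N)%nat ->
        vnorm (vsub (u n) (u m)) < eps) ->
    exists x : X, Un_cv (fun n => vnorm (vsub (u n) x)) 0.

Definition is_dual {X : NormedSpace} (f : X -> R) : Prop :=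
  (forall x y, f (vadd x y) = f x + f y) /\
  (forall a x, f (vscal a x) = a * f x) /\
  (exists C, forall x, Rabs (f x) <= C * vnorm x).

Definition dual_norm {X : NormedSpace} (f : X -> R) : R :=
  epsilon (inhabits 0)
    (fun r => is_lub (fun y => exists x : X, vnorm x <= 1 /\ y = Rabs (f x)) r).

Definition reflexive (X : NormedSpace) : Prop :=
  forall Phi : (X -> R) -> R,
    (forall f g, is_dual f -> is_dual g -> Phi (fun x => f x + g x) = Phi f + Phi g) ->
    (forall a f, is_dual f -> Phi (fun x => a * f x) = a * Phi f) ->
    (exists C, forall f, is_dual f -> Rabs (Phi f) <= C * dual_norm f) ->
    exists x : X, forall f, is_dual f -> Phi f = f x.

Definition Banach (X : NormedSpace) : Prop := complete X.

Definition locally_lipschitz {X : NormedSpace} (phi : X -> R) : Prop :=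
  forall u : X, exists r L, r > 0 /\
    forall x y, vnorm (vsub x u) < r -> vnorm (vsub y u) < r ->
      Rabs (phi x - phi y) <= L * vnorm (vsub x y).

Definition is_clarke_limsup {X : NormedSpace} (phi : X -> R) (u v : X) (L : R) : Prop :=
  (forall eps, eps > 0 -> exists delta, delta > 0 /\
     forall w t, vnorm (vsub w u) < delta -> 0 < t < delta ->
       (phi (vadd w (vscal t v)) - phi w) / t < L + eps) /\
  (forall eps delta, eps > 0 -> delta > 0 -> exists w t,
     vnorm (vsub w u) < delta /\ 0 < t < delta /\
       (phi (vadd w (vscal t v)) - phi w) / t > L - eps).

(** Clarke directional derivative phi°(u;v) (finite for locally Lipschitz phi). *)
Definition clarke_dd {X : NormedSpace} (phi : X -> R) (u v : X) : R :=
  epsilon (inhabits 0) (is_clarke_limsup phi u v).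

Definition clarke_subdiff {X : NormedSpace} (phi : X -> R) (u : X) (f : X -> R) : Prop :=
  is_dual f /\ forall v : X, f v <= clarke_dd phi u v.

Definition is_min_norm_subgrad {X : NormedSpace} (phi : X -> R) (u : X) (r : R) : Prop :=
  (exists f, clarke_subdiff phi u f /\ dual_norm f = r) /\
  (forall f, clarke_subdiff phi u f -> r <= dual_norm f).

Definition m_phi {X : NormedSpace} (phi : X -> R) (u : X) : R :=
  epsilon (inhabits 0) (is_min_norm_subgrad phi u).

Definition critical {X : NormedSpace} (phi : X -> R) (u : X) : Prop := m_phi phi u = 0.

(** Extended levels: [None] stands for +infinity. *)
Definition K_level {X : NormedSpace} (phi : X -> R) (c : option R) (u : X) : Prop :=
  match c with
  | Some c => critical phi u /\ phi u = c
  | None => False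
  end.

Definition sublevel {X : NormedSpace} (phi : X -> R) (c : option R) (u : X) : Prop :=
  match c with
  | Some c => phi u <= c
  | None => True
  end.

Definition cerami {X : NormedSpace} (phi : X -> R) : Prop :=
  forall u : nat -> X,
    (exists M, forall n, Rabs (phi (u n)) <= M) ->
    Un_cv (fun n => (1 + vnorm (u n)) * m_phi phi (u n)) 0 ->
    exists (sigma : nat -> nat) (x : X),
      (forall n, (sigma n < sigma (S n))%nat) /\
      Un_cv (fun n => vnorm (vsub (u (sigma n)) x)) 0.

Definition lt_ext (a : R) (b : option R) : Prop :=
  match b with Some b => a < b | None => True end.

Definition continuous_on_IxS {X : NormedSpace} (S : X -> Prop) (h : R -> X -> X) : Prop :=
  forall t u, 0 <= t <= 1 -> S u -> forall eps, eps > 0 -> exists delta, delta > 0 /\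
    forall s w, 0 <= s <= 1 -> S w -> Rabs (s - t) < delta -> vnorm (vsub w u) < delta ->
      vnorm (vsub (h s w) (h t u)) < eps.

(* Main.v *)
Require Import Defs.
From Stdlib Require Import Reals Lra Lia List Classical ClassicalEpsilon Cantor.
From mathcomp Require boolp classical_sets wochoice.
Open Scope R_scope.
Set Bullet Behavior "Strict Subproofs".

(** A noncritical point [p] has a unit direction [v] along which [phi] decreases at rate at
    least [m(p)/2], uniformly near [p]: otherwise Hahn-Banach, applied to the infimal
    convolution of the Clarke derivative with a multiple of the norm, yields a subgradient that
    is too small.

    No pseudo-gradient flow is integrated.  Following M. E. Rudin's proof that metric spaces
    are paracompact, a well-ordering of [X] splits the descent balls above level [a] into
    countably many families, the [n]-th one [2^-n]-discrete; moving inside each ball of the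
    [n]-th family along its own direction is a continuous step that decreases [phi] and stays
    above level [a].  Every step is applied infinitely often.  By the Cerami condition an orbit
    either has finite length or clusters at a critical point, and in both cases at level [a];
    around a point of level [a] an annulus free of [K_a] has slopes bounded below, which traps
    every orbit entering near the point.  So orbits converge, and the limit depends
    continuously on the starting point. *)

(** The obstacle is the limit at time 1: an orbit is an infinite composition of continuous steps,
    and neither its convergence nor the continuity of its limit follows from the steps alone. Both
    come from the trap near level [a], whose size depends on the target point and the tolerance but
    not on the orbit. The dichotomy on orbits is governed by the Cerami weight at the centres of the
    balls in use. If [(1 + vnorm p) * m_phi phi p] is eventually bounded below, the length obeys a
    Gronwall inequality. Otherwise the Cerami condition is applied to centres, and the orbit points
    follow them: a descent ball contains no critical point, so its radius is at most the distance
    from its centre to the critical limit. Convergence to a point above [a] is excluded because near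
    a noncritical point some scale lowers [phi] by a fixed amount. Level [b] matters only at the
    start, since every nonzero step strictly decreases [phi] and the critical points at level [b]
    are removed. *)

(** * Order principles, choice and infima *)

Lemma zorn_preorder (T : Type) (t0 : T) (R : T -> T -> Prop) :
  (forall t, R t t) -> (forall r s t, R r s -> R s t -> R r t) ->
  (forall A : T -> Prop, (forall s t, A s -> A t -> R s t \/ R t s) ->
     exists t, forall s, A s -> R s t) ->
  exists t, forall s, R t s -> R s t.
Proof.
  intros Hr Ht Hc.
  destruct (@classical_sets.ZL_preorder T t0 (fun s t => boolp.asbool (R s t))) as [t Hm].
  - intros t. apply boolp.asboolT, Hr.
  - intros r s t Hrs Hst. apply boolp.asboolT.
    apply boolp.asboolW in Hrs. apply boolp.asboolW in Hst. exact (Ht _ _ _ Hrs Hst).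
  - intros A HA. destruct (Hc A) as [t Hs].
    + intros s t As At. destruct (HA s t As At) as [H|H]; apply boolp.asboolW in H; tauto.
    + exists t. intros s As. apply boolp.asboolT, Hs, As.
  - exists t. intros s Hs. apply boolp.asboolW, Hm, boolp.asboolT, Hs.
Qed.

(** Every nonempty set has a unique [R]-least element, and [lt x y] is the failure of [R y x].
    Singletons give reflexivity of [R]; uniqueness of the least element of a pair then gives
    comparability. *)
Lemma well_order_exists (T : Type) : exists lt : T -> T -> Prop,
  (forall x y, x <> y -> lt x y \/ lt y x) /\
  (forall P : T -> Prop, (exists x, P x) -> exists x, P x /\ forall y, P y -> ~ lt y x).
Proof.
  destruct (wochoice.well_ordering_principle
    (boolp.boolp_classicType__canonical__eqtype_Equality T)) as [R HR].
  assert (Hmin : forall P : T -> Prop, (exists x, P x) ->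
      exists z, (P z /\ forall y, P y -> R z y = true) /\
        forall z', P z' -> (forall y, P y -> R z' y = true) -> z = z').
  { intros P [x Px].
    destruct (HR (fun y => boolp.asbool (P y))) as [z [[Pz Hz] Hu]].
    - exists x. apply boolp.asboolT, Px.
    - exists z. split; [split|].
      + apply boolp.asboolW, Pz.
      + intros y Py. apply Hz. apply boolp.asboolT, Py.
      + intros z' Pz' Hz'. apply Hu. split.
        * apply boolp.asboolT, Pz'.
        * intros y Py. apply Hz'. apply boolp.asboolW, Py. }
  exists (fun x y => R y x <> true). split.
  - intros x y Hxy. apply NNPP. intros Hn. apply Hxy.
    assert (Ryx : R y x = true) by (destruct (R y x); tauto).
    assert (Rxy : R x y = true) by (destruct (R x y); tauto).
    assert (Rr : forall w, R w w = true).
    { intros w. destruct (Hmin (fun z => z = w)) as [z [[Hzw H] _]]; [now exists w|subst z; auto]. }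
    destruct (Hmin (fun z => z = x \/ z = y)) as [z [_ Hu]]; [exists x; tauto|].
    transitivity z; [symmetry|]; apply Hu; try tauto; intros w [ -> | -> ]; auto.
  - intros P HP. destruct (Hmin P HP) as [z [[Pz Hz] _]].
    exists z. split; [assumption|]. intros y Py H. exact (H (Hz y Py)).
Qed.

Lemma functional_choice_epsilon {A B : Type} (P : A -> B -> Prop) :
  (forall x, exists y, P x y) -> exists f : A -> B, forall x, P x (f x).
Proof.
  intros H.
  exists (fun x => proj1_sig (constructive_indefinite_description _ (H x))).
  intros x. apply proj2_sig.
Qed.

Lemma Rabs_le_inv r c : Rabs r <= c -> - c <= r <= c.
Proof. intros H. pose proof (Rle_abs r). pose proof (Rle_abs (- r)). rewrite Rabs_Ropp in *. lra. Qed.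

Lemma glb_exists (E : R -> Prop) (m : R) :
  (exists x, E x) -> (forall x, E x -> m <= x) ->
  exists g, (forall x, E x -> g <= x) /\ (forall e, e > 0 -> exists x, E x /\ x < g + e).
Proof.
  intros [x0 Hx0] Hm.
  destruct (completeness (fun y => E (- y))) as [l [Hu Hl]].
  - exists (- m). intros y Hy. specialize (Hm _ Hy). lra.
  - exists (- x0). now rewrite Ropp_involutive.
  - exists (- l). split.
    + intros x Hx. enough (- x <= l) by lra. apply Hu. now rewrite Ropp_involutive.
    + intros e He. apply NNPP. intros Hn.
      enough (l <= l - e) by lra. apply Hl. intros y Hy.
      apply Rnot_lt_le. intros Hlt. apply Hn. exists (- y). split; [assumption|lra].
Qed.

(** * Vector identities *)

Inductive vexp := VVar (n : nat) | VAdd (e f : vexp) | VScal (r : R) (e : vexp) | VZero.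

Fixpoint veval {X : NormedSpace} (env : list X) (e : vexp) : X :=
  match e with
  | VVar n => nth n env vzero
  | VAdd e f => vadd (veval env e) (veval env f)
  | VScal r e => vscal r (veval env e)
  | VZero => vzero
  end.

Fixpoint vcoef (n : nat) (e : vexp) : R :=
  match e with
  | VVar m => if Nat.eqb m n then 1 else 0
  | VAdd e f => vcoef n e + vcoef n f
  | VScal r e => r * vcoef n e
  | VZero => 0
  end.

Fixpoint lincomb {X : NormedSpace} (c : nat -> R) (k : nat) (env : list X) : X :=
  match env with
  | nil => vzero
  | cons x l => vadd (vscal (c k) x) (lincomb c (S k) l)
  end.

Section VectorIdentities.
Context {X : NormedSpace}.
Implicit Types (x y z : X) (env : list X).

Lemma vscal_0 x : vscal 0 x = vzero.
Proof.
  replace 0 with (1 + -1) by ring.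
  rewrite vscal_distr_s, vscal_1. apply vadd_opp.
Qed.

Lemma vscal_zero r : vscal r (@vzero X) = vzero.
Proof. rewrite <- (vscal_0 vzero), vscal_assoc. f_equal. ring. Qed.

Lemma lincomb_add c d k env :
  lincomb (fun n => c n + d n) k env = vadd (lincomb c k env) (lincomb d k env).
Proof.
  revert k. induction env as [|x env IH]; intros k; simpl.
  - now rewrite vadd_0.
  - rewrite IH, vscal_distr_s, <- !vadd_assoc. f_equal.
    rewrite !vadd_assoc. f_equal. apply vadd_comm.
Qed.

Lemma lincomb_scal r c k env :
  lincomb (fun n => r * c n) k env = vscal r (lincomb c k env).
Proof.
  revert k. induction env as [|x env IH]; intros k; simpl.
  - now rewrite vscal_zero.
  - now rewrite IH, vscal_distr_v, vscal_assoc.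
Qed.

Lemma lincomb_ext c d k env :
  (forall n, (k <= n < k + length env)%nat -> c n = d n) -> lincomb c k env = lincomb d k env.
Proof.
  revert k. induction env as [|x env IH]; intros k H; simpl; [reflexivity|].
  rewrite (H k), (IH (S k)); [reflexivity| |simpl; lia].
  intros n Hn. apply H. simpl. lia.
Qed.

Lemma lincomb_0 k env : lincomb (fun _ => 0) k env = vzero.
Proof.
  revert k. induction env as [|x env IH]; intros k; simpl; [reflexivity|].
  now rewrite IH, vscal_0, vadd_0.
Qed.

Lemma lincomb_var m k env :
  lincomb (fun n => if Nat.eqb (k + m) n then 1 else 0) k env = nth m env vzero.
Proof.
  revert k m. induction env as [|x env IH]; intros k m.
  - now destruct m.
  - simpl lincomb. destruct m as [|m]; simpl nth.
    + rewrite Nat.add_0_r, Nat.eqb_refl, vscal_1.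
      rewrite (lincomb_ext _ (fun _ => 0)), lincomb_0; [apply vadd_0|].
      intros n Hn. destruct (Nat.eqb_spec k n); [lia|reflexivity].
    + destruct (Nat.eqb_spec (k + S m) k); [lia|].
      rewrite vscal_0, vadd_comm, vadd_0, <- (IH (S k) m).
      apply lincomb_ext. intros j _. now rewrite Nat.add_succ_r.
Qed.

Lemma veval_lincomb env e : veval env e = lincomb (fun n => vcoef n e) 0 env.
Proof.
  induction e as [m|e IHe f IHf|r e IHe|]; simpl.
  - symmetry. apply (lincomb_var m 0).
  - now rewrite IHe, IHf, lincomb_add.
  - now rewrite IHe, lincomb_scal.
  - now rewrite lincomb_0.
Qed.

Lemma veval_eq env e f :
  lincomb (fun n => vcoef n e) 0 env = lincomb (fun n => vcoef n f) 0 env ->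
  veval env e = veval env f.
Proof. now rewrite !veval_lincomb. Qed.
End VectorIdentities.

Ltac v_insert x env :=
  let rec mem l := lazymatch l with
    | nil => constr:(cons x env)
    | cons x _ => constr:(env)
    | cons _ ?l' => mem l'
    end in mem env.

Ltac v_atoms env e :=
  lazymatch e with
  | vadd ?a ?b => let env' := v_atoms env a in v_atoms env' b
  | vscal _ ?a => v_atoms env a
  | vzero => env
  | ?x => v_insert x env
  end.

Ltac v_index x env :=
  lazymatch env with
  | cons x _ => constr:(O)
  | cons _ ?l => let n := v_index x l in constr:(S n)
  end.

Ltac v_reify env e :=
  lazymatch e with
  | vadd ?a ?b => let a' := v_reify env a in let b' := v_reify env b in constr:(VAdd a' b')
  | vscal ?r ?a => let a' := v_reify env a in constr:(VScal r a')
  | vzero => constr:(VZero)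
  | ?x => let n := v_index x env in constr:(VVar n)
  end.

(** Proof by reflection of linear identities: both sides are reified over a common list of atoms,
    and the identity is reduced to one scalar equation per atom. *)
Ltac vec :=
  unfold vsub;
  lazymatch goal with |- @eq (carrier ?X) ?e ?f =>
    let env0 := v_atoms constr:(@nil (carrier X)) e in
    let env := v_atoms env0 f in
    let e' := v_reify env e in
    let f' := v_reify env f in
    change (veval env e' = veval env f');
    apply veval_eq; cbv beta iota delta [lincomb vcoef Nat.eqb];
    repeat (apply f_equal2;
      [apply (f_equal2 vscal); [first [ring | field; lra] | reflexivity] |]);
    reflexivity
  end.

(** * The distance of a normed space *)

Section Norm.
Context {X : NormedSpace}.
Implicit Types x y z v w : X.

Lemma vnorm_vzero : vnorm (@vzero X) = 0.
Proof. rewrite <- (vscal_0 vzero), vnorm_scal, Rabs_R0. ring. Qed.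

Lemma vdist_refl x : vnorm (vsub x x) = 0.
Proof. replace (vsub x x) with (@vzero X) by vec. apply vnorm_vzero. Qed.

Lemma vdist_sym x y : vnorm (vsub x y) = vnorm (vsub y x).
Proof.
  replace (vsub x y) with (vscal (-1) (vsub y x)) by vec.
  rewrite vnorm_scal, (Rabs_left (-1)); lra.
Qed.

Lemma vdist_triangle x y z : vnorm (vsub x z) <= vnorm (vsub x y) + vnorm (vsub y z).
Proof. replace (vsub x z) with (vadd (vsub x y) (vsub y z)) by vec. apply vnorm_triangle. Qed.

Lemma vdist_translate x v : vnorm (vsub (vadd x v) x) = vnorm v.
Proof. f_equal. vec. Qed.

Lemma vnorm_scal_pos t v : 0 <= t -> vnorm (vscal t v) = t * vnorm v.
Proof. intros Ht. now rewrite vnorm_scal, Rabs_pos_eq. Qed.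

Lemma vnorm_dist_le x y : vnorm x <= vnorm y + vnorm (vsub x y).
Proof. replace x with (vadd y (vsub x y)) at 1 by vec. apply vnorm_triangle. Qed.

Lemma vdist_eq0 x y : vnorm (vsub x y) = 0 -> x = y.
Proof.
  intros H. apply vnorm_eq0 in H. replace x with (vadd (vsub x y) y) by vec.
  rewrite H. vec.
Qed.
End Norm.

(** * Sublinear functionals *)

Section HahnBanach.
Context {X : NormedSpace}.
Implicit Types (x y z v w : X) (p q f : X -> R).

(** Homogeneity is stated as an inequality for [0 < t], the form that infima inherit; scaling back
    by [/ t] recovers equality. *)
Definition sublinear p : Prop :=
  (forall x y, p (vadd x y) <= p x + p y) /\
  (forall t x, 0 < t -> p (vscal t x) <= t * p x).

Lemma sublinear_pos_homogeneous p t x :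
  sublinear p -> 0 < t -> p (vscal t x) = t * p x.
Proof.
  intros [_ Hh] Ht. apply Rle_antisym; [now apply Hh|].
  assert (Hi : 0 < / t) by now apply Rinv_0_lt_compat.
  pose proof (Hh (/ t) (vscal t x) Hi) as H.
  replace (vscal (/ t) (vscal t x)) with x in H by vec.
  apply (Rmult_le_compat_l t) in H; [|lra].
  replace (t * (/ t * p (vscal t x))) with (p (vscal t x)) in H by (field; lra). exact H.
Qed.

Lemma sublinear_vzero p : sublinear p -> p vzero = 0.
Proof.
  intros H. pose proof (sublinear_pos_homogeneous p 2 vzero H ltac:(lra)) as E.
  rewrite vscal_zero in E. lra.
Qed.

Lemma sublinear_opp_ge p x : sublinear p -> - p (vscal (-1) x) <= p x.
Proof.
  intros H. pose proof (proj1 H x (vscal (-1) x)) as E.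
  rewrite vadd_opp, sublinear_vzero in E by assumption. lra.
Qed.

(** Common scheme for three constructions: the infimum along a ray, the infimum of a chain, and the
    infimal convolution with the norm. [E x] is the set of values whose infimum is taken at [x], and
    [m] keeps it bounded below. *)
Lemma sublinear_inf (E : X -> R -> Prop) (m : X -> R) :
  (forall x, exists r, E x r) -> (forall x r, E x r -> m x <= r) ->
  (forall x y r s, E x r -> E y s -> exists c, E (vadd x y) c /\ c <= r + s) ->
  (forall t x r, 0 < t -> E x r -> exists c, E (vscal t x) c /\ c <= t * r) ->
  exists q, sublinear q /\ (forall x r, E x r -> q x <= r) /\
    (forall x d, (forall r, E x r -> d <= r) -> d <= q x).
Proof.
  intros Hne Hm Hadd Hhom.
  destruct (functional_choice_epsilon (fun x g => (forall r, E x r -> g <= r) /\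
     forall e, e > 0 -> exists r, E x r /\ r < g + e)) as [q Hq].
  { intros x. apply (glb_exists (E x) (m x)); [apply Hne|apply Hm]. }
  assert (Hglb : forall x d, (forall r, E x r -> d <= r) -> d <= q x).
  { intros x d Hd. apply le_epsilon. intros e He.
    destruct (proj2 (Hq x) e He) as [r [Er Hr]]. specialize (Hd r Er). lra. }
  exists q. repeat split; [| |intros x r; apply (Hq x)|exact Hglb].
  - intros x y. apply le_epsilon. intros e He.
    destruct (proj2 (Hq x) (e / 2)) as [r [Er Hr]]; [lra|].
    destruct (proj2 (Hq y) (e / 2)) as [s [Es Hs]]; [lra|].
    destruct (Hadd x y r s Er Es) as [c [Ec Hc]].
    pose proof (proj1 (Hq _) c Ec). lra.
  - intros t x Ht. apply le_epsilon. intros e He.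
    destruct (proj2 (Hq x) (e / t)) as [r [Er Hr]]; [now apply Rdiv_lt_0_compat|].
    destruct (Hhom t x r Ht Er) as [c [Ec Hc]].
    pose proof (proj1 (Hq _) c Ec).
    apply (Rmult_lt_compat_l t) in Hr; [|assumption].
    replace (t * (q x + e / t)) with (t * q x + e) in Hr by (field; lra). lra.
Qed.

(** For fixed [y], the infimum over [t >= 0] of [q (x + t y) - t * q y] is sublinear and lies below
    [q]. By minimality it equals [q], and [t = 1] gives superadditivity. *)
Lemma sublinear_minimal_linear q :
  sublinear q ->
  (forall q', sublinear q' -> (forall x, q' x <= q x) -> forall x, q x <= q' x) ->
  (forall x y, q (vadd x y) = q x + q y) /\ (forall t x, q (vscal t x) = t * q x).
Proof.
  intros Hq Hmin.
  assert (Hadd : forall x y, q (vadd x y) = q x + q y).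
  { intros x y. apply Rle_antisym; [apply Hq|].
    destruct (sublinear_inf
      (fun x r => exists t, 0 <= t /\ r = q (vadd x (vscal t y)) - t * q y)
      (fun x => - q (vscal (-1) x))) as [q' [Hq' [Hle _]]].
    - intros z. exists (q (vadd z (vscal 0 y)) - 0 * q y), 0. split; [lra|reflexivity].
    - intros z r [t [[Ht|Ht] ->]].
      + rewrite <- (sublinear_pos_homogeneous q t y Hq Ht).
        pose proof (proj1 Hq (vadd z (vscal t y)) (vscal (-1) z)) as H.
        replace (vadd (vadd z (vscal t y)) (vscal (-1) z)) with (vscal t y) in H by vec. lra.
      + subst t. replace (vadd z (vscal 0 y)) with z by vec.
        pose proof (sublinear_opp_ge q z Hq). lra.
    - intros z w r s [t1 [Ht1 ->]] [t2 [Ht2 ->]].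
      exists (q (vadd (vadd z w) (vscal (t1 + t2) y)) - (t1 + t2) * q y). split.
      + exists (t1 + t2). split; [lra|reflexivity].
      + pose proof (proj1 Hq (vadd z (vscal t1 y)) (vadd w (vscal t2 y))) as H.
        replace (vadd (vadd z (vscal t1 y)) (vadd w (vscal t2 y)))
          with (vadd (vadd z w) (vscal (t1 + t2) y)) in H by vec. lra.
    - intros t z r Ht [s [Hs ->]].
      exists (q (vadd (vscal t z) (vscal (t * s) y)) - (t * s) * q y). split.
      + exists (t * s). split; [now apply Rmult_le_pos; lra|reflexivity].
      + pose proof (proj2 Hq t (vadd z (vscal s y)) Ht) as H.
        replace (vscal t (vadd z (vscal s y))) with (vadd (vscal t z) (vscal (t * s) y)) in H by vec.
        lra.
    - assert (H0 : forall z, q' z <= q z).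
      { intros z. apply Hle. exists 0. split; [lra|].
        replace (vadd z (vscal 0 y)) with z by vec. ring. }
      pose proof (Hmin q' Hq' H0 x) as H1.
      assert (H2 : q' x <= q (vadd x y) - q y).
      { apply Hle. exists 1. split; [lra|]. rewrite vscal_1. ring. }
      lra. }
  split; [exact Hadd|].
  assert (Hopp : forall x, q (vscal (-1) x) = - q x).
  { intros x. pose proof (Hadd x (vscal (-1) x)) as H.
    rewrite vadd_opp, sublinear_vzero in H by assumption. lra. }
  intros t x. destruct (Rtotal_order t 0) as [Ht|[Ht|Ht]].
  - replace (vscal t x) with (vscal (-1) (vscal (- t) x)) by vec.
    rewrite Hopp, sublinear_pos_homogeneous by (assumption || lra). ring.
  - subst t. rewrite vscal_0, sublinear_vzero by assumption. ring.
  - now apply sublinear_pos_homogeneous.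
Qed.

(** Instead of extending from subspaces, Zorn is applied to the sublinear functionals below [p],
    ordered downwards; a minimal one is linear. *)
Lemma hahn_banach p :
  sublinear p ->
  exists f, (forall x y, f (vadd x y) = f x + f y) /\
    (forall t x, f (vscal t x) = t * f x) /\ (forall x, f x <= p x).
Proof.
  intros Hp.
  pose (T := { q : X -> R | sublinear q /\ forall x, q x <= p x }).
  assert (t0 : T) by (exists p; split; [assumption|intros; lra]).
  destruct (zorn_preorder T t0
    (fun s t : T => forall x, proj1_sig t x <= proj1_sig s x)) as [[q [Hq Hqp]] Hmax].
  - intros; lra.
  - intros r s t Hrs Hst x. specialize (Hrs x). specialize (Hst x). lra.
  - intros A HA. destruct (classic (exists s, A s)) as [Hne|Hne].
    + destruct (sublinear_inf (fun x r => exists s, A s /\ r = proj1_sig s x)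
        (fun x => - p (vscal (-1) x))) as [q [Hq [Hle _]]].
      * intros x. destruct Hne as [s As]. now exists (proj1_sig s x), s.
      * intros x r [[s [Hs Hsp]] [_ ->]]. simpl.
        pose proof (sublinear_opp_ge s x Hs). specialize (Hsp (vscal (-1) x)). lra.
      * intros x y r r' [s [As ->]] [s' [As' ->]].
        (* Two members of the chain are comparable, so the smaller one bounds the infimum at the
           sum. *)
        destruct (HA s s' As As') as [H|H].
        -- exists (proj1_sig s' (vadd x y)). split; [now exists s'|].
           pose proof (proj1 (proj1 (proj2_sig s')) x y). specialize (H x). lra.
        -- exists (proj1_sig s (vadd x y)). split; [now exists s|].
           pose proof (proj1 (proj1 (proj2_sig s)) x y). specialize (H y). lra.
      * intros t x r Ht [s [As ->]].
        exists (proj1_sig s (vscal t x)). split; [now exists s|].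
        now apply (proj2 (proj1 (proj2_sig s))).
      * assert (Hqp : forall x, q x <= p x).
        { intros x. destruct Hne as [s As].
          apply Rle_trans with (proj1_sig s x); [apply Hle; now exists s|].
          apply (proj2_sig s). }
        exists (exist _ q (conj Hq Hqp)). intros s As x. apply Hle. now exists s.
    + exists t0. intros s As. exfalso. eauto.
  - destruct (sublinear_minimal_linear q Hq) as [Ha Hh].
    + intros q' Hq' Hle.
      assert (Hq'p : forall x, q' x <= p x).
      { intros x. eapply Rle_trans; [apply Hle|apply Hqp]. }
      exact (Hmax (exist _ q' (conj Hq' Hq'p)) Hle).
    + exists q. auto.
Qed.

(* Hahn-Banach for the infimal convolution of [p] and [eps * vnorm]. *)
Lemma hahn_banach_bounded_below p eps :
  sublinear p -> 0 <= eps -> (forall v, - (eps * vnorm v) <= p v) ->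
  exists f, (forall x y, f (vadd x y) = f x + f y) /\
    (forall t x, f (vscal t x) = t * f x) /\ (forall x, f x <= p x) /\
    (forall x, Rabs (f x) <= eps * vnorm x).
Proof.
  intros Hp He Hb.
  destruct (sublinear_inf (fun x r => exists w, r = p w + eps * vnorm (vsub x w))
    (fun x => - (eps * vnorm x))) as [q [Hq [Hle _]]].
  - intros x. now exists (p vzero + eps * vnorm (vsub x vzero)), vzero.
  - intros x r [w ->]. specialize (Hb w).
    pose proof (vnorm_dist_le w x) as H. rewrite vdist_sym in H.
    apply (Rmult_le_compat_l eps) in H; lra.
  - intros x y r s [w1 ->] [w2 ->].
    exists (p (vadd w1 w2) + eps * vnorm (vsub (vadd x y) (vadd w1 w2))). split; [eauto|].
    pose proof (proj1 Hp w1 w2).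
    pose proof (vnorm_triangle _ (vsub x w1) (vsub y w2)) as H1.
    replace (vadd (vsub x w1) (vsub y w2)) with (vsub (vadd x y) (vadd w1 w2)) in H1 by vec.
    apply (Rmult_le_compat_l eps) in H1; lra.
  - intros t x r Ht [w ->].
    exists (p (vscal t w) + eps * vnorm (vsub (vscal t x) (vscal t w))). split; [eauto|].
    pose proof (proj2 Hp t w Ht).
    replace (vsub (vscal t x) (vscal t w)) with (vscal t (vsub x w)) by vec.
    rewrite vnorm_scal_pos by lra. lra.
  - destruct (hahn_banach q Hq) as [f [Ha [Hh Hf]]].
    assert (Hfe : forall x, f x <= eps * vnorm x).
    { intros x. eapply Rle_trans; [apply Hf|]. apply Hle. exists vzero.
      rewrite sublinear_vzero by assumption. replace (vsub x vzero) with x by vec. ring. }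
    exists f. repeat split; auto.
    + intros x. eapply Rle_trans; [apply Hf|]. apply Hle. exists x.
      rewrite vdist_refl. ring.
    + intros x. apply Rabs_le. split; [|apply Hfe].
      specialize (Hfe (vscal (-1) x)). rewrite Hh, vnorm_scal, (Rabs_left (-1)) in Hfe; lra.
Qed.
End HahnBanach.

(** * The Clarke derivative and the minimal subgradient norm *)

Section Clarke.
Context {X : NormedSpace}.
Implicit Types (x u v w : X) (f : X -> R).

Lemma dual_norm_lub f : is_dual f ->
  is_lub (fun y => exists x : X, vnorm x <= 1 /\ y = Rabs (f x)) (dual_norm f).
Proof.
  intros [_ [_ [C HC]]]. unfold dual_norm. apply epsilon_spec.
  destruct (completeness (fun y => exists x : X, vnorm x <= 1 /\ y = Rabs (f x))) as [l Hl].
  - exists (Rabs C). intros y [x [Hx ->]]. eapply Rle_trans; [apply HC|].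
    pose proof (vnorm_nonneg _ x). pose proof (Rle_abs C). pose proof (Rabs_pos C).
    apply Rle_trans with (Rabs C * vnorm x); nra.
  - exists (Rabs (f vzero)), vzero. rewrite vnorm_vzero. split; [lra|reflexivity].
  - now exists l.
Qed.

Lemma dual_norm_ge f x : is_dual f -> vnorm x <= 1 -> Rabs (f x) <= dual_norm f.
Proof. intros Hf Hx. apply (dual_norm_lub f Hf). now exists x. Qed.

Lemma dual_norm_le f C : is_dual f -> 0 <= C ->
  (forall x, Rabs (f x) <= C * vnorm x) -> dual_norm f <= C.
Proof.
  intros Hf HC0 HC. apply (dual_norm_lub f Hf). intros y [x [Hx ->]].
  eapply Rle_trans; [apply HC|]. pose proof (vnorm_nonneg _ x). nra.
Qed.

Lemma dual_norm_nonneg f : is_dual f -> 0 <= dual_norm f.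
Proof.
  intros Hf. eapply Rle_trans; [apply (Rabs_pos (f vzero))|].
  apply dual_norm_ge; [assumption|]. rewrite vnorm_vzero. lra.
Qed.

Lemma dual_norm_bound f x : is_dual f -> Rabs (f x) <= dual_norm f * vnorm x.
Proof.
  intros Hf. destruct (vnorm_nonneg _ x) as [Hx|Hx].
  - assert (Hi : 0 < / vnorm x) by now apply Rinv_0_lt_compat.
    pose proof (dual_norm_ge f (vscal (/ vnorm x) x) Hf) as H.
    rewrite vnorm_scal_pos, Rinv_l in H by lra. specialize (H (Rle_refl 1)).
    rewrite (proj1 (proj2 Hf)), Rabs_mult, (Rabs_pos_eq (/ vnorm x)) in H by lra.
    apply (Rmult_le_compat_r (vnorm x)) in H; [|lra].
    replace (/ vnorm x * Rabs (f x) * vnorm x) with (Rabs (f x)) in H by (field; lra). exact H.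
  - destruct Hf as [_ [_ [C HC]]]. specialize (HC x). rewrite <- Hx in HC |- *. lra.
Qed.

Variable phi : X -> R.
Hypothesis Hlip : locally_lipschitz phi.

Lemma locally_lipschitz_continuous u eps : eps > 0 ->
  exists delta, delta > 0 /\ forall w, vnorm (vsub w u) < delta -> Rabs (phi w - phi u) < eps.
Proof.
  intros He. destruct (Hlip u) as [r [L [Hr HL]]].
  pose proof (Rabs_pos L) as HL0.
  exists (Rmin r (eps / (Rabs L + 1))). split.
  - apply Rmin_pos; [assumption|]. apply Rdiv_lt_0_compat; lra.
  - intros w Hw.
    assert (Hw1 : vnorm (vsub w u) < r) by (eapply Rlt_le_trans; [apply Hw|apply Rmin_l]).
    assert (Hw2 : vnorm (vsub w u) < eps / (Rabs L + 1))
      by (eapply Rlt_le_trans; [apply Hw|apply Rmin_r]).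
    specialize (HL w u Hw1). rewrite vdist_refl in HL. specialize (HL Hr).
    apply (Rmult_lt_compat_r (Rabs L + 1)) in Hw2; [|lra].
    replace (eps / (Rabs L + 1) * (Rabs L + 1)) with eps in Hw2 by (field; lra).
    pose proof (Rle_abs L). pose proof (vnorm_nonneg _ (vsub w u)). nra.
Qed.

Lemma clarke_quotient_bounded u : exists L, 0 <= L /\ forall v, exists d, d > 0 /\
  forall w t, vnorm (vsub w u) < d -> 0 < t < d ->
    Rabs ((phi (vadd w (vscal t v)) - phi w) / t) <= L * vnorm v.
Proof.
  destruct (Hlip u) as [r [L [Hr HL]]].
  exists (Rabs L). split; [apply Rabs_pos|]. intros v.
  pose proof (vnorm_nonneg _ v) as Hv.
  (* This radius keeps both [w] and [w + t v] in the Lipschitz ball. It depends on [v], while the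
     constant [L] does not. *)
  exists (r / (2 + vnorm v)). split; [apply Rdiv_lt_0_compat; lra|].
  intros w t Hw [Ht0 Ht].
  set (d := r / (2 + vnorm v)) in *.
  assert (Hd : d * (2 + vnorm v) = r) by (unfold d; field; lra).
  assert (Hd0 : 0 < d) by (unfold d; apply Rdiv_lt_0_compat; lra).
  assert (H1 : vnorm (vsub (vadd w (vscal t v)) w) = t * vnorm v)
    by (rewrite vdist_translate, vnorm_scal_pos; lra).
  pose proof (vdist_triangle (vadd w (vscal t v)) w u) as H2.
  assert (H3 : Rabs (phi (vadd w (vscal t v)) - phi w) <= L * (t * vnorm v)).
  { rewrite <- H1. apply HL; nra. }
  unfold Rdiv. rewrite Rabs_mult, (Rabs_pos_eq (/ t)) by (left; now apply Rinv_0_lt_compat).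
  apply Rmult_le_reg_r with t; [assumption|].
  replace (Rabs (phi (vadd w (vscal t v)) - phi w) * / t * t)
    with (Rabs (phi (vadd w (vscal t v)) - phi w)) by (field; lra).
  pose proof (Rle_abs L). eapply Rle_trans; [apply H3|].
  replace (Rabs L * vnorm v * t) with (Rabs L * (t * vnorm v)) by ring.
  apply Rmult_le_compat_r; [|assumption]. apply Rmult_le_pos; lra.
Qed.

(** The limsup is obtained as the infimum of the eventual upper bounds of the difference
    quotient. *)
Lemma clarke_dd_spec u v : is_clarke_limsup phi u v (clarke_dd phi u v).
Proof.
  unfold clarke_dd. apply epsilon_spec.
  destruct (clarke_quotient_bounded u) as [L [_ HL]].
  destruct (HL v) as [d [Hd Hb]].
  destruct (glb_exists (fun M => exists d, d > 0 /\ forall w t, vnorm (vsub w u) < d ->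
      0 < t < d -> (phi (vadd w (vscal t v)) - phi w) / t <= M) (- (L * vnorm v)))
    as [g [Hg1 Hg2]].
  - exists (L * vnorm v), d. split; [assumption|]. intros w t Hw Ht.
    eapply Rle_trans; [apply Rle_abs|]. now apply Hb.
  - intros M [d' [Hd' HM]].
    set (t := Rmin d d' / 2).
    assert (Hm : 0 < Rmin d d') by (apply Rmin_pos; assumption).
    pose proof (Rmin_l d d'). pose proof (Rmin_r d d').
    assert (Hu : forall e, e > 0 -> vnorm (vsub u u) < e) by (intros; rewrite vdist_refl; lra).
    specialize (HM u t (Hu _ Hd') ltac:(unfold t; lra)).
    specialize (Hb u t (Hu _ Hd) ltac:(unfold t; lra)).
    apply Rabs_le_inv in Hb. lra.
  - exists g. split.
    + intros e He. destruct (Hg2 e He) as [M [[d' [Hd' HM]] HMg]].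
      exists d'. split; [assumption|]. intros w t Hw Ht. specialize (HM w t Hw Ht). lra.
    + intros e d' He Hd'. apply NNPP. intros Hn.
      enough (g <= g - e) by lra. apply Hg1. exists d'. split; [assumption|].
      intros w t Hw Ht. apply Rnot_lt_le. intros Hlt. apply Hn. exists w, t. auto.
Qed.

(** From here on the limsup enters only through this bound and its near-converse [clarke_dd_lt],
    both free of division. *)
Lemma clarke_dd_le u v M d : d > 0 ->
  (forall w t, vnorm (vsub w u) < d -> 0 < t < d ->
     phi (vadd w (vscal t v)) - phi w <= t * M) ->
  clarke_dd phi u v <= M.
Proof.
  intros Hd H. apply le_epsilon. intros e He.
  destruct (proj2 (clarke_dd_spec u v) e d He Hd) as [w [t [Hw [Ht Hq]]]].
  specialize (H w t Hw Ht).
  enough ((phi (vadd w (vscal t v)) - phi w) / t <= M) by lra.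
  apply Rmult_le_reg_r with t; [lra|].
  replace ((phi (vadd w (vscal t v)) - phi w) / t * t)
    with (phi (vadd w (vscal t v)) - phi w) by (field; lra). lra.
Qed.

Lemma clarke_dd_lt u v M : clarke_dd phi u v < M -> exists d, d > 0 /\
  forall w t, vnorm (vsub w u) < d -> 0 < t < d ->
     phi (vadd w (vscal t v)) - phi w <= t * M.
Proof.
  intros H. destruct (proj1 (clarke_dd_spec u v) (M - clarke_dd phi u v)) as [d [Hd Hq]]; [lra|].
  exists d. split; [assumption|]. intros w t Hw Ht. specialize (Hq w t Hw Ht).
  replace (phi (vadd w (vscal t v)) - phi w)
    with (t * ((phi (vadd w (vscal t v)) - phi w) / t)) by (field; lra).
  apply Rmult_le_compat_l; lra.
Qed.

(** For subadditivity the increment along [t (v + v')] is split at [w + t v]. This point serves as a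
    new base point, which is allowed because the limsup also runs over base points near [u]. *)
Lemma clarke_dd_sublinear u : sublinear (clarke_dd phi u).
Proof.
  split.
  - intros v v'. apply le_epsilon. intros e He.
    destruct (clarke_dd_lt u v (clarke_dd phi u v + e / 2)) as [d [Hd H]]; [lra|].
    destruct (clarke_dd_lt u v' (clarke_dd phi u v' + e / 2)) as [d' [Hd' H']]; [lra|].
    set (c := Rmin d d'). assert (Hc : 0 < c) by (apply Rmin_pos; assumption).
    assert (Hcd : c <= d) by apply Rmin_l. assert (Hcd' : c <= d') by apply Rmin_r.
    pose proof (vnorm_nonneg _ v) as Hv.
    assert (Hk : 0 < c / (2 + vnorm v)) by (apply Rdiv_lt_0_compat; lra).
    assert (Hk2 : c / (2 + vnorm v) * (2 + vnorm v) = c) by (field; lra).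
    apply clarke_dd_le with (c / (2 + vnorm v)); [lra|].
    set (k := c / (2 + vnorm v)) in *.
    intros w t Hw Ht.
    pose proof (vdist_triangle (vadd w (vscal t v)) w u) as Hd1.
    rewrite vdist_translate, vnorm_scal_pos in Hd1 by lra.
    specialize (H w t ltac:(nra) ltac:(nra)).
    specialize (H' (vadd w (vscal t v)) t ltac:(nra) ltac:(nra)).
    replace (vadd (vadd w (vscal t v)) (vscal t v')) with (vadd w (vscal t (vadd v v')))
      in H' by vec.
    replace (t * (clarke_dd phi u v + clarke_dd phi u v' + e)) with
      (t * (clarke_dd phi u v + e / 2) + t * (clarke_dd phi u v' + e / 2)) by field.
    lra.
  - intros s v Hs. apply le_epsilon. intros e He.
    destruct (clarke_dd_lt u v (clarke_dd phi u v + e / s)) as [d [Hd H]].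
    { assert (0 < e / s) by (apply Rdiv_lt_0_compat; lra). lra. }
    set (k := Rmin d (d / s)).
    assert (Hds : 0 < d / s) by (apply Rdiv_lt_0_compat; lra).
    assert (Hds2 : d / s * s = d) by (field; lra).
    assert (Hk : 0 < k) by (apply Rmin_pos; assumption).
    assert (Hk1 : k <= d) by apply Rmin_l. assert (Hk2 : k <= d / s) by apply Rmin_r.
    apply clarke_dd_le with k; [lra|]. intros w t Hw Ht.
    specialize (H w (t * s) ltac:(lra) ltac:(nra)).
    replace (vscal t (vscal s v)) with (vscal (t * s) v) by vec.
    replace (t * (s * clarke_dd phi u v + e)) with (t * s * (clarke_dd phi u v + e / s))
      by (field; lra). exact H.
Qed.

Lemma clarke_dd_bounded u : exists L, 0 <= L /\ forall v, clarke_dd phi u v <= L * vnorm v.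
Proof.
  destruct (clarke_quotient_bounded u) as [L [HL0 HL]]. exists L. split; [assumption|].
  intros v. destruct (HL v) as [d [Hd H]]. apply clarke_dd_le with d; [assumption|].
  intros w t Hw Ht. specialize (H w t Hw Ht). apply Rabs_le_inv in H.
  replace (phi (vadd w (vscal t v)) - phi w)
    with (t * ((phi (vadd w (vscal t v)) - phi w) / t)) by (field; lra).
  apply Rmult_le_compat_l; lra.
Qed.

(** Turns lower bounds on the Clarke derivative into subgradients; attainment of the minimal norm
    and existence of descent directions both reduce to it. *)
Lemma clarke_subdiff_small u eps : 0 <= eps ->
  (forall v, - (eps * vnorm v) <= clarke_dd phi u v) ->
  exists f, clarke_subdiff phi u f /\ dual_norm f <= eps.
Proof.
  intros He Hb.
  destruct (hahn_banach_bounded_below _ eps (clarke_dd_sublinear u) He Hb)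
    as [f [Ha [Hh [Hf Hn]]]].
  assert (Hd : is_dual f) by (repeat split; eauto).
  exists f. repeat split; eauto. now apply dual_norm_le.
Qed.

(* The minimum is attained because a lower bound [- eps * vnorm v <= clarke_dd phi u v]
   valid for every [eps > g] passes to [eps = g]; no weak* compactness is needed. *)
Lemma m_phi_spec u : is_min_norm_subgrad phi u (m_phi phi u).
Proof.
  unfold m_phi. apply epsilon_spec.
  destruct (clarke_dd_bounded u) as [L [HL0 HL]].
  destruct (glb_exists (fun r => exists f, clarke_subdiff phi u f /\ dual_norm f = r) 0)
    as [g [Hg1 Hg2]].
  - destruct (clarke_subdiff_small u L HL0) as [f [Hf _]]; [|eauto].
    intros v. pose proof (sublinear_opp_ge _ v (clarke_dd_sublinear u)) as H.
    specialize (HL (vscal (-1) v)). rewrite vnorm_scal, (Rabs_left (-1)) in HL; lra.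
  - intros r [f [[Hf _] <-]]. now apply dual_norm_nonneg.
  - assert (Hg0 : 0 <= g).
    { apply le_epsilon. intros e He. destruct (Hg2 e He) as [r [[f [[Hf _] Hr]] Hlt]].
      pose proof (dual_norm_nonneg f Hf). lra. }
    destruct (clarke_subdiff_small u g Hg0) as [f [Hf Hfg]].
    + intros v. apply le_epsilon. intros e He. pose proof (vnorm_nonneg _ v) as Hv.
      destruct (Hg2 (e / (1 + vnorm v))) as [r [[f [[Hf Hfd] Hr]] Hlt]];
        [apply Rdiv_lt_0_compat; lra|].
      pose proof (dual_norm_bound f v Hf) as Hb. rewrite Hr in Hb.
      apply Rabs_le_inv in Hb. specialize (Hfd v).
      assert (Hk : 0 < e / (1 + vnorm v)) by (apply Rdiv_lt_0_compat; lra).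
      assert (Hk2 : e / (1 + vnorm v) * (1 + vnorm v) = e) by (field; lra). nra.
    + exists g. split.
      * exists f. split; [assumption|]. apply Rle_antisym; [assumption|]. apply Hg1. eauto.
      * intros f' Hf'. apply Hg1. eauto.
Qed.

Lemma m_phi_nonneg u : 0 <= m_phi phi u.
Proof.
  destruct (m_phi_spec u) as [[f [[Hf _] <-]] _]. now apply dual_norm_nonneg.
Qed.

Lemma m_phi_descent u : m_phi phi u <> 0 ->
  exists v d, vnorm v <= 1 /\ d > 0 /\
    forall w t, vnorm (vsub w u) < d -> 0 < t < d ->
      phi (vadd w (vscal t v)) <= phi w - t * (m_phi phi u / 2).
Proof.
  intros Hm. pose proof (m_phi_nonneg u) as Hm0.
  assert (Hex : exists v, vnorm v <= 1 /\ clarke_dd phi u v < - (m_phi phi u / 2)).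
  { apply NNPP. intros Hn.
    destruct (clarke_subdiff_small u (m_phi phi u / 2)) as [f [Hf Hfn]]; [lra| |].
    - intros v. destruct (vnorm_nonneg _ v) as [Hv|Hv].
      + assert (Hi : 0 < / vnorm v) by now apply Rinv_0_lt_compat.
        pose proof (sublinear_pos_homogeneous _ _ v (clarke_dd_sublinear u) Hi) as H.
        apply Rnot_lt_le. intros Hlt. apply Hn. exists (vscal (/ vnorm v) v).
        rewrite vnorm_scal_pos, Rinv_l, H by lra. split; [lra|].
        apply Rmult_lt_reg_l with (vnorm v); [assumption|].
        replace (vnorm v * (/ vnorm v * clarke_dd phi u v)) with (clarke_dd phi u v)
          by (field; lra). lra.
      + symmetry in Hv. apply vnorm_eq0 in Hv. subst v.
        rewrite vnorm_vzero, sublinear_vzero by apply clarke_dd_sublinear. lra.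
    - pose proof (proj2 (m_phi_spec u) f Hf). lra. }
  destruct Hex as [v [Hv Hdd]]. destruct (clarke_dd_lt _ _ _ Hdd) as [d [Hd H]].
  exists v, d. repeat split; try assumption. intros w t Hw Ht. specialize (H w t Hw Ht). lra.
Qed.

(** Converse to [m_phi_descent]: every subgradient [f] has [f v <= - s], hence norm at least [s]. It
    carries slope bounds from a point to its neighbours, in place of lower semicontinuity of
    [m_phi]. *)
Lemma m_phi_ge u v s d : vnorm v <= 1 -> d > 0 ->
  (forall w t, vnorm (vsub w u) < d -> 0 < t < d ->
      phi (vadd w (vscal t v)) <= phi w - t * s) ->
  s <= m_phi phi u.
Proof.
  intros Hv Hd H. destruct (m_phi_spec u) as [[f [[Hf Hfd] <-]] _].
  assert (Hdd : clarke_dd phi u v <= - s).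
  { apply clarke_dd_le with d; [assumption|]. intros w t Hw Ht. specialize (H w t Hw Ht). lra. }
  pose proof (dual_norm_ge f v Hf Hv) as Hn. apply Rabs_le_inv in Hn.
  specialize (Hfd v). lra.
Qed.
End Clarke.

(** * Descent trajectories *)

Lemma inv_INR_S_small eps : eps > 0 -> exists N, forall n, (N <= n)%nat -> / INR (S n) < eps.
Proof.
  intros He. destruct (archimed_cor1 eps He) as [N [HN HN0]]. exists N. intros n Hn.
  apply Rle_lt_trans with (/ INR N); [|assumption].
  apply Rinv_le_contravar; [apply lt_0_INR; lia|apply le_INR; lia].
Qed.

Lemma inv_INR_S_pos n : 0 < / INR (S n).
Proof. apply Rinv_0_lt_compat, lt_0_INR. lia. Qed.

Lemma strict_increasing_ge (sigma : nat -> nat) :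
  (forall n, (sigma n < sigma (S n))%nat) -> forall n, (n <= sigma n)%nat.
Proof. intros H n. induction n as [|n IH]; [lia|]. specialize (H n). lia. Qed.

Lemma continuity_of_lipschitz (f : R -> R) C :
  (forall s t, Rabs (f s - f t) <= C * Rabs (s - t)) -> continuity f.
Proof.
  intros H t eps He. exists (eps / (Rabs C + 1)). pose proof (Rabs_pos C).
  split; [apply Rdiv_lt_0_compat; lra|].
  intros s [_ Hs]. simpl in *. unfold Rdist in *.
  eapply Rle_lt_trans; [apply H|].
  apply (Rmult_lt_compat_r (Rabs C + 1)) in Hs; [|lra].
  replace (eps / (Rabs C + 1) * (Rabs C + 1)) with eps in Hs by (field; lra).
  pose proof (Rle_abs C). pose proof (Rabs_pos (s - t)). nra.
Qed.

Definition tends {X : NormedSpace} (x : nat -> X) (z : X) : Prop :=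
  forall eps, eps > 0 -> exists N, forall n, (N <= n)%nat -> vnorm (vsub (x n) z) < eps.

Lemma Un_cv_tends {X : NormedSpace} (x : nat -> X) z :
  Un_cv (fun n => vnorm (vsub (x n) z)) 0 -> tends x z.
Proof.
  intros H eps He. destruct (H eps He) as [N HN]. exists N. intros n Hn.
  specialize (HN n Hn). unfold Rdist in HN. rewrite Rminus_0_r, Rabs_pos_eq in HN; [assumption|].
  apply vnorm_nonneg.
Qed.

Section Trajectories.
Context {X : NormedSpace}.
Implicit Types p q u v w y z : X.
Variable phi : X -> R.
Hypothesis Hlip : locally_lipschitz phi.
Hypothesis HC : cerami phi.
Variable a : R.

(* The level condition keeps the ball above level [a] and makes [phi p] close to [a]
   as soon as some value of [phi] on the ball is. *)
Definition descent_ball p v r : Prop :=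
  a < phi p /\ m_phi phi p <> 0 /\ 0 < r <= 1 /\ vnorm v <= 1 /\
  (forall w t, vnorm (vsub w p) < r -> 0 < t < r ->
     phi (vadd w (vscal t v)) <= phi w - t * (m_phi phi p / 2)) /\
  (forall w, vnorm (vsub w p) < r -> (phi p - a) / 2 <= phi w - a).

(** The bound [vnorm (vsub u p) + l < r] keeps the whole segment from [u] to [u + l v] in the ball,
    so intermediate points satisfy the same estimates as the endpoint. *)
Definition descent_step u w : Prop :=
  w = vzero \/ exists p v r l,
    descent_ball p v r /\ 0 < l /\ vnorm (vsub u p) + l < r /\ w = vscal l v.

Definition trajectory (x w : nat -> X) : Prop :=
  forall k, descent_step (x k) (w k) /\ x (S k) = vadd (x k) (w k).

Lemma descent_ball_exists p : a < phi p -> m_phi phi p <> 0 -> exists v r, descent_ball p v r.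
Proof.
  intros Hp Hm. destruct (m_phi_descent phi Hlip p Hm) as [v [d [Hv [Hd H]]]].
  destruct (locally_lipschitz_continuous phi Hlip p ((phi p - a) / 2)) as [e [He Hc]]; [lra|].
  (* The cap 1 makes [vnorm p] comparable with the norms of points of the ball, and bounds the bump
     functions built from the radii. *)
  exists v, (Rmin 1 (Rmin d e)).
  assert (H0 : 0 < Rmin 1 (Rmin d e)) by (repeat apply Rmin_pos; lra).
  pose proof (Rmin_l 1 (Rmin d e)). pose proof (Rmin_r 1 (Rmin d e)).
  pose proof (Rmin_l d e). pose proof (Rmin_r d e).
  repeat split; try lra; try assumption.
  - intros w t Hw Ht. apply H; lra.
  - intros w Hw. specialize (Hc w ltac:(lra)). apply Rabs_def2 in Hc. lra.
Qed.

Lemma descent_ball_m_phi_ge p v r u : descent_ball p v r -> vnorm (vsub u p) < r ->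
  m_phi phi p / 2 <= m_phi phi u.
Proof.
  intros (_ & _ & Hr & Hv & H & _) Hu.
  apply (m_phi_ge phi Hlip u v _ (r - vnorm (vsub u p))); [assumption|lra|].
  intros w t Hw Ht. pose proof (vdist_triangle w u p). pose proof (vnorm_nonneg _ (vsub u p)).
  apply H; lra.
Qed.

(** The same direction descends at rate [m_phi phi p / 2] near every point of the ball. Hence steps
    never create critical points, and balls shrink near them. *)
Lemma descent_ball_noncritical p v r u : descent_ball p v r -> vnorm (vsub u p) < r ->
  m_phi phi u <> 0.
Proof.
  intros Hb Hu. pose proof (descent_ball_m_phi_ge _ _ _ _ Hb Hu).
  destruct Hb as (_ & Hm & _). pose proof (m_phi_nonneg phi Hlip p). lra.
Qed.

Lemma descent_ball_above p v r u : descent_ball p v r -> vnorm (vsub u p) < r -> a < phi u.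
Proof. intros (Hp & _ & _ & _ & _ & H) Hu. specialize (H u Hu). lra. Qed.

Lemma descent_ball_segment p v r u l t : descent_ball p v r -> 0 < l ->
  vnorm (vsub u p) + l < r -> 0 <= t <= 1 ->
  vnorm (vsub (vadd u (vscal t (vscal l v))) p) < r /\
  phi (vadd u (vscal t (vscal l v))) <= phi u - t * l * (m_phi phi p / 2).
Proof.
  intros (_ & _ & Hr & Hv & H & _) Hl Hu Ht. pose proof (vnorm_nonneg _ v).
  pose proof (vnorm_nonneg _ (vsub u p)).
  assert (Htl : 0 <= t * l <= l) by nra.
  replace (vscal t (vscal l v)) with (vscal (t * l) v) by vec. split.
  - pose proof (vdist_triangle (vadd u (vscal (t * l) v)) u p) as Htri.
    rewrite vdist_translate, vnorm_scal_pos in Htri by lra. nra.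
  - destruct (proj1 Htl) as [Hp|Hz].
    + apply H; lra.
    + rewrite <- Hz. replace (vadd u (vscal 0 v)) with u by vec. lra.
Qed.

Lemma descent_step_le u w t : descent_step u w -> 0 <= t <= 1 ->
  phi (vadd u (vscal t w)) <= phi u.
Proof.
  intros [ -> | (p & v & r & l & Hb & Hl & Hu & ->)] Ht.
  - replace (vadd u (vscal t vzero)) with u by vec. lra.
  - destruct (descent_ball_segment _ _ _ _ _ _ Hb Hl Hu Ht) as [_ H].
    pose proof (m_phi_nonneg phi Hlip p). assert (0 <= t * l) by nra. nra.
Qed.

Lemma descent_step_above u w t : descent_step u w -> 0 <= t <= 1 ->
  a < phi u -> a < phi (vadd u (vscal t w)).
Proof.
  intros [ -> | (p & v & r & l & Hb & Hl & Hu & ->)] Ht H.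
  - replace (vadd u (vscal t vzero)) with u by vec. lra.
  - eapply descent_ball_above; [exact Hb|]. now apply descent_ball_segment.
Qed.

Lemma descent_step_noncritical u w t : descent_step u w -> 0 <= t <= 1 ->
  m_phi phi u <> 0 -> m_phi phi (vadd u (vscal t w)) <> 0.
Proof.
  intros [ -> | (p & v & r & l & Hb & Hl & Hu & ->)] Ht H.
  - now replace (vadd u (vscal t vzero)) with u by vec.
  - eapply descent_ball_noncritical; [exact Hb|]. now apply descent_ball_segment.
Qed.

(** The Cerami condition makes the centres subconverge to some [q]. If [q] were noncritical, slopes
    near it would be at least half of its own, whereas those of the centres tend to 0. As no ball
    contains the critical point [q], the radii tend to 0 along the subsequence and [u] has the same
    limit. *)
Lemma cerami_descent_balls (p v u : nat -> X) (r : nat -> R) :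
  (forall k, descent_ball (p k) (v k) (r k)) ->
  (forall k, vnorm (vsub (u k) (p k)) < r k) ->
  (exists M, forall k, Rabs (phi (p k)) <= M) ->
  Un_cv (fun k => (1 + vnorm (p k)) * m_phi phi (p k)) 0 ->
  exists (sigma : nat -> nat) q, (forall n, (n <= sigma n)%nat) /\ m_phi phi q = 0 /\
    tends (fun k => u (sigma k)) q.
Proof.
  intros Hb Hu HM Hcv. destruct (HC p HM Hcv) as [sigma [q [Hs Hq]]].
  apply (Un_cv_tends (fun n => p (sigma n))) in Hq.
  pose proof (strict_increasing_ge sigma Hs) as Hsn.
  exists sigma, q. split; [assumption|].
  assert (Hcrit : m_phi phi q = 0).
  { apply NNPP. intros Hm. pose proof (m_phi_nonneg phi Hlip q).
    destruct (m_phi_descent phi Hlip q Hm) as [v' [d [Hv' [Hd H']]]].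
    destruct (Hq (d / 2)) as [N HN]; [lra|].
    destruct (Hcv (m_phi phi q / 2)) as [N' HN']; [lra|].
    pose proof (Hsn (N + N')%nat) as Hge. specialize (HN (N + N')%nat ltac:(lia)).
    set (k := sigma (N + N')%nat) in *.
    specialize (HN' k ltac:(lia)). unfold Rdist in HN'. rewrite Rminus_0_r in HN'.
    apply Rabs_def2 in HN'.
    assert (Hge' : m_phi phi q / 2 <= m_phi phi (p k)).
    { apply (m_phi_ge phi Hlip _ v' _ (d / 2)); [assumption|lra|].
      intros w t Hw Ht. pose proof (vdist_triangle w (p k) q). apply H'; lra. }
    pose proof (vnorm_nonneg _ (p k)). pose proof (m_phi_nonneg phi Hlip (p k)). nra. }
  split; [assumption|].
  intros eps He. destruct (Hq (eps / 2)) as [N HN]; [lra|]. exists N. intros n Hn.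
  specialize (HN n Hn).
  assert (Hr : r (sigma n) <= vnorm (vsub (p (sigma n)) q)).
  { apply Rnot_lt_le. intros Hlt. rewrite vdist_sym in Hlt.
    now apply (descent_ball_noncritical _ _ _ _ (Hb _) Hlt). }
  pose proof (vdist_triangle (u (sigma n)) (p (sigma n)) q). specialize (Hu (sigma n)). lra.
Qed.

Lemma tends_phi (x : nat -> X) z : tends x z -> forall eps, eps > 0 ->
  exists N, forall n, (N <= n)%nat -> Rabs (phi (x n) - phi z) < eps.
Proof.
  intros H eps He. destruct (locally_lipschitz_continuous phi Hlip z eps He) as [d [Hd Hc]].
  destruct (H d Hd) as [N HN]. exists N. intros n Hn. now apply Hc, HN.
Qed.

(** * Trapping near level [a] *)

(** Compactness by contradiction: slopes tending to 0 at levels tending to [a] would produce a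
    critical point of level [a] in the closed annulus. Boundedness of the annulus absorbs the weight
    of the Cerami condition. *)
Lemma slope_bound_on_annulus z r : 0 < r ->
  (forall q, m_phi phi q = 0 -> phi q = a -> ~ (r <= vnorm (vsub q z) <= 2 * r)) ->
  exists c eta, c > 0 /\ eta > 0 /\ forall p v rho u, descent_ball p v rho ->
    vnorm (vsub u p) < rho -> r <= vnorm (vsub u z) <= 2 * r -> phi u < a + eta ->
    c <= m_phi phi p.
Proof.
  intros Hr HK. apply NNPP. intros Hn.
  destruct (functional_choice_epsilon (fun (k : nat) (s : X * X * R * X) =>
    let '(p, v, rho, u) := s in descent_ball p v rho /\ vnorm (vsub u p) < rho /\
      r <= vnorm (vsub u z) <= 2 * r /\ phi u < a + / INR (S k) /\
      m_phi phi p < / INR (S k))) as [s Hs].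
  { intros k. apply NNPP. intros Hk. apply Hn. pose proof (inv_INR_S_pos k).
    exists (/ INR (S k)), (/ INR (S k)). repeat split; try lra.
    intros p v rho u Hb Hu Hz Ha. apply Rnot_lt_le. intros Hlt. apply Hk.
    now exists (p, v, rho, u). }
  pose (p := fun k => fst (fst (fst (s k)))). pose (v := fun k => snd (fst (fst (s k)))).
  pose (rho := fun k => snd (fst (s k))). pose (u := fun k => snd (s k)).
  assert (Hs' : forall k, descent_ball (p k) (v k) (rho k) /\ vnorm (vsub (u k) (p k)) < rho k /\
      r <= vnorm (vsub (u k) z) <= 2 * r /\ phi (u k) < a + / INR (S k) /\
      m_phi phi (p k) < / INR (S k)).
  { intros k. specialize (Hs k). unfold p, v, rho, u.
    destruct (s k) as [[[p' v'] rho'] u']. exact Hs. }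
  assert (Hinv1 : forall k, / INR (S k) <= 1).
  { intros k. rewrite <- Rinv_1. apply Rinv_le_contravar; [lra|].
    rewrite S_INR. pose proof (pos_INR k). lra. }
  destruct (cerami_descent_balls p v u rho) as [sigma [q [Hsig [Hq Hlim]]]].
  - intros k. apply Hs'.
  - intros k. apply Hs'.
  (* The level condition of the ball gives [phi p - a <= 2 * (phi u - a)], and [phi u - a] is below
     1. *)
  - exists (Rabs a + 2). intros k.
    destruct (Hs' k) as (Hb & Hu & _ & Hphi & _).
    destruct Hb as (Hp & _ & _ & _ & _ & Hlev). specialize (Hlev _ Hu). specialize (Hinv1 k).
    replace (phi (p k)) with (a + (phi (p k) - a)) by ring.
    eapply Rle_trans; [apply Rabs_triang|]. rewrite (Rabs_pos_eq (phi (p k) - a)); lra.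
  - intros eps He. pose proof (vnorm_nonneg _ z) as Hz0.
    destruct (inv_INR_S_small (eps / (2 + vnorm z + 2 * r))) as [N HN];
      [apply Rdiv_lt_0_compat; lra|].
    exists N. intros k Hk. specialize (HN k Hk).
    destruct (Hs' k) as (Hb & Hu & Hz & _ & Hm).
    destruct Hb as (_ & _ & Hrho & _).
    assert (Hp : 1 + vnorm (p k) <= 2 + vnorm z + 2 * r).
    { pose proof (vnorm_dist_le (p k) z). pose proof (vdist_triangle (p k) (u k) z).
      rewrite (vdist_sym (p k) (u k)) in *. lra. }
    pose proof (m_phi_nonneg phi Hlip (p k)). pose proof (vnorm_nonneg _ (p k)).
    unfold Rdist. rewrite Rminus_0_r, Rabs_pos_eq by nra.
    apply (Rmult_lt_compat_r (2 + vnorm z + 2 * r)) in HN; [|lra].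
    replace (eps / (2 + vnorm z + 2 * r) * (2 + vnorm z + 2 * r)) with eps in HN by (field; lra).
    nra.
  - assert (Hphi : phi q = a).
    { apply Rle_antisym; apply le_epsilon; intros e He;
        destruct (tends_phi _ _ Hlim (e / 2)) as [N HN]; try lra;
        destruct (inv_INR_S_small (e / 2)) as [N' HN']; try lra;
        specialize (HN (N + N')%nat ltac:(lia)); pose proof (Hsig (N + N')%nat);
        specialize (HN' (sigma (N + N')%nat) ltac:(lia));
        destruct (Hs' (sigma (N + N')%nat)) as (Hb & Hu & _ & Ha & _);
        pose proof (descent_ball_above _ _ _ _ Hb Hu); apply Rabs_def2 in HN; lra. }
    apply (HK q Hq Hphi).
    split; apply le_epsilon; intros e He; destruct (Hlim e He) as [N HN];
      specialize (HN N (le_n N)); destruct (Hs' (sigma N)) as (_ & _ & Hz & _).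
    + pose proof (vdist_triangle (u (sigma N)) q z). lra.
    + pose proof (vdist_triangle q (u (sigma N)) z).
      rewrite (vdist_sym q (u (sigma N))) in *. lra.
Qed.

Hypothesis HKa : exists l : list X, forall u, m_phi phi u = 0 -> phi u = a -> In u l.

(** Finiteness of the critical set at level [a] leaves a punctured ball around [z] free of it; [z]
    itself may be critical. *)
Lemma isolating_radius z eps : eps > 0 -> exists r, 0 < r /\ 2 * r < eps /\
  forall q, m_phi phi q = 0 -> phi q = a -> ~ (r <= vnorm (vsub q z) <= 2 * r).
Proof.
  intros He. destruct HKa as [l Hl].
  enough (H : exists r, 0 < r /\ 2 * r < eps /\
    forall q, In q l -> ~ (0 < vnorm (vsub q z) <= 2 * r)).
  { destruct H as (r & Hr & Hre & H). exists r. repeat split; try assumption.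
    intros q Hq Hqa Hd. apply (H q); [auto|lra]. }
  clear Hl. induction l as [|q l IH].
  - exists (eps / 3). repeat split; try lra. intros q [].
  - destruct IH as (r & Hr & Hre & H).
    destruct (vnorm_nonneg _ (vsub q z)) as [Hq|Hq].
    + exists (Rmin r (vnorm (vsub q z) / 4)).
      pose proof (Rmin_l r (vnorm (vsub q z) / 4)). pose proof (Rmin_r r (vnorm (vsub q z) / 4)).
      assert (0 < Rmin r (vnorm (vsub q z) / 4)) by (apply Rmin_pos; lra).
      repeat split; try lra. intros q' [ <- |Hin] Hd; [lra|]. apply (H q' Hin). lra.
    + exists r. repeat split; try lra. intros q' [ <- |Hin] Hd; [lra|]. now apply (H q' Hin).
Qed.

(* The potential [phi + (c/2) (|.-z| - r)^+] does not increase along a descent step while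
   [phi] is close to [a]: a step meeting the annulus has slope at least [c/2]. *)
Lemma potential_step c eta z r M y w t : 0 < r -> 0 < c ->
  (forall p v rho u, descent_ball p v rho -> vnorm (vsub u p) < rho ->
     r <= vnorm (vsub u z) <= 2 * r -> phi u < a + eta -> c <= m_phi phi p) ->
  M < a + eta -> M < a + c / 2 * r -> a <= phi y ->
  phi y + c / 2 * Rmax 0 (vnorm (vsub y z) - r) <= M ->
  descent_step y w -> 0 <= t <= 1 ->
  phi (vadd y (vscal t w)) + c / 2 * Rmax 0 (vnorm (vsub (vadd y (vscal t w)) z) - r) <= M.
Proof.
  intros Hr Hc Hann HM1 HM2 Hy HQ Hw Ht.
  destruct Hw as [ -> | (p & v & rho & l & Hb & Hl & Hu & ->)].
  { now replace (vadd y (vscal t vzero)) with y by vec. }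
  destruct (descent_ball_segment _ _ _ _ _ _ Hb Hl Hu Ht) as [Hin Hdec].
  set (y' := vadd y (vscal t (vscal l v))) in *.
  pose proof (Rmax_l 0 (vnorm (vsub y z) - r)). pose proof (Rmax_r 0 (vnorm (vsub y z) - r)).
  assert (Hy2 : vnorm (vsub y z) < 2 * r).
  { apply Rnot_le_lt. intros Hle. nra. }
  assert (Hphiy : phi y <= M) by nra.
  assert (Hv : vnorm v <= 1) by apply Hb.
  assert (Hyy' : vnorm (vsub y' y) <= t * l).
  { unfold y'. rewrite vdist_translate, !vnorm_scal_pos by lra. assert (0 <= t * l) by nra.
    pose proof (vnorm_nonneg _ v). nra. }
  assert (Htl : 0 <= t * l) by nra.
  pose proof (m_phi_nonneg phi Hlip p) as Hm0.
  assert (Hfast : c <= m_phi phi p ->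
    phi y' + c / 2 * Rmax 0 (vnorm (vsub y' z) - r) <= M).
  { intros Hcm. pose proof (vdist_triangle y' y z).
    assert (Rmax 0 (vnorm (vsub y' z) - r) <= Rmax 0 (vnorm (vsub y z) - r) + t * l)
      by (apply Rmax_lub; lra).
    nra. }
  destruct (Rle_lt_dec r (vnorm (vsub y z))) as [Hyr|Hyr].
  { apply Hfast, (Hann p v rho y); try assumption; lra. }
  destruct (Rlt_le_dec (vnorm (vsub y' z)) r) as [Hy'r|Hy'r].
  { rewrite (Rmax_left 0 (vnorm (vsub y' z) - r)) by lra. nra. }
  apply Hfast.
  (* The step leaves the inner ball, so it crosses the inner sphere. The crossing point lies in the
     annulus and in the same descent ball, which bounds the slope at the centre [p]. *)
  destruct (IVT_cor (fun s => vnorm (vsub (vadd y (vscal (s * t) (vscal l v))) z) - r) 0 1)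
    as [s [Hs Hs0]].
  - apply continuity_of_lipschitz with (vnorm (vscal t (vscal l v))). intros s s'.
    replace (vnorm (vsub (vadd y (vscal (s * t) (vscal l v))) z) - r -
      (vnorm (vsub (vadd y (vscal (s' * t) (vscal l v))) z) - r)) with
      (vnorm (vsub (vadd y (vscal (s * t) (vscal l v))) z) -
       vnorm (vsub (vadd y (vscal (s' * t) (vscal l v))) z)) by ring.
    assert (Hd : forall s s', vnorm (vsub (vadd y (vscal (s * t) (vscal l v))) z) -
       vnorm (vsub (vadd y (vscal (s' * t) (vscal l v))) z) <=
       vnorm (vscal t (vscal l v)) * Rabs (s - s')).
    { intros x x'.
      pose proof (vdist_triangle (vadd y (vscal (x * t) (vscal l v)))
        (vadd y (vscal (x' * t) (vscal l v))) z) as Htri.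
      replace (vsub (vadd y (vscal (x * t) (vscal l v))) (vadd y (vscal (x' * t) (vscal l v))))
        with (vscal (x - x') (vscal t (vscal l v))) in Htri by vec.
      rewrite (vnorm_scal _ (x - x')) in Htri. lra. }
    apply Rabs_le. pose proof (Hd s s'). pose proof (Hd s' s).
    rewrite (Rabs_minus_sym s' s) in *. lra.
  - lra.
  - rewrite Rmult_0_l, Rmult_1_l. fold y'.
    replace (vadd y (vscal 0 (vscal l v))) with y by vec. nra.
  - assert (Hst : 0 <= s * t <= 1) by nra.
    destruct (descent_ball_segment _ _ _ _ _ _ Hb Hl Hu Hst) as [Hin2 Hdec2].
    assert (0 <= s * t * l) by nra.
    apply (Hann p v rho (vadd y (vscal (s * t) (vscal l v)))); try assumption; try lra. nra.
Qed.

(** At time [K] the potential equals [phi (x K)], close to [a], and it never exceeds that value;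
    distance [2 * r] from [z] would require at least [a + c / 2 * r]. The radius [delta] is chosen
    before the trajectory and [K], which later yields continuity of the limit. *)
Lemma trajectory_trapped z eps : phi z = a -> eps > 0 -> exists delta, delta > 0 /\
  forall (x w : nat -> X) K, trajectory x w -> vnorm (vsub (x K) z) < delta -> a < phi (x K) ->
    forall j t, (K <= j)%nat -> 0 <= t <= 1 -> vnorm (vsub (vadd (x j) (vscal t (w j))) z) < eps.
Proof.
  intros Hz He. destruct (isolating_radius z eps He) as (r & Hr & Hre & HK).
  destruct (slope_bound_on_annulus z r Hr HK) as (c & eta & Hc & Heta & Hann).
  (* Below [a + eta] the annulus is steep; [c / 2 * r] is the height of the barrier at distance
     [2 * r]. *)
  destruct (locally_lipschitz_continuous phi Hlip z (Rmin eta (c / 2 * r))) as [d [Hd Hphi]].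
  { apply Rmin_pos; nra. }
  exists (Rmin d r). split; [now apply Rmin_pos|].
  intros x w K Hx HxK HaK.
  pose proof (Rmin_l d r). pose proof (Rmin_r d r).
  pose proof (Rmin_l eta (c / 2 * r)). pose proof (Rmin_r eta (c / 2 * r)).
  specialize (Hphi (x K) ltac:(lra)). rewrite Hz in Hphi. apply Rabs_def2 in Hphi.
  set (Q := fun y => phi y + c / 2 * Rmax 0 (vnorm (vsub y z) - r)).
  assert (Hstep : forall y w t, a < phi y -> Q y <= phi (x K) -> descent_step y w ->
    0 <= t <= 1 -> Q (vadd y (vscal t w)) <= phi (x K)).
  { intros y w' t Hy HQ Hw Ht. apply (potential_step c eta); try assumption; lra. }
  assert (Hvert : forall j, (K <= j)%nat -> a < phi (x j) /\ Q (x j) <= phi (x K)).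
  { intros j Hj. induction Hj as [|j Hj [IH1 IH2]].
    - split; [assumption|]. unfold Q. rewrite Rmax_left by lra. lra.
    - destruct (Hx j) as [Hw ->].
      replace (vadd (x j) (w j)) with (vadd (x j) (vscal 1 (w j))) by vec.
      split; [apply descent_step_above|apply Hstep]; auto; lra. }
  intros j t Hj Ht. destruct (Hvert j Hj) as [Hj1 Hj2]. destruct (Hx j) as [Hw _].
  pose proof (Hstep _ _ t Hj1 Hj2 Hw Ht) as HQ.
  pose proof (descent_step_above _ _ t Hw Ht Hj1).
  unfold Q in HQ. set (y := vadd (x j) (vscal t (w j))) in *.
  pose proof (Rmax_r 0 (vnorm (vsub y z) - r)).
  enough (vnorm (vsub y z) < 2 * r) by lra. apply Rnot_le_lt. intros Hle. nra.
Qed.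
End Trajectories.

(** * Convergence of single trajectories *)

Fixpoint partial_sum (f : nat -> R) (k : nat) : R :=
  match k with O => 0 | S k => partial_sum f k + f k end.

(** Discrete Gronwall inequality: each step multiplies [C + partial_sum l k] by at most
    [1 + d k / e <= exp (d k / e)]. In the application [d] is the decrease of [phi], and the factor
    [C + partial_sum l k] dominates the Cerami weight. *)
Lemma logarithmic_length_bound (l d : nat -> R) (C e D : R) :
  0 < C -> 0 < e -> (forall k, 0 <= l k) -> (forall k, partial_sum d k <= D) ->
  (forall k, e * l k <= d k * (C + partial_sum l k)) ->
  forall k, C + partial_sum l k <= C * exp (D / e).
Proof.
  intros HC He Hl HD H.
  assert (Hpos : forall k, 0 < C + partial_sum l k).
  { intros k. induction k as [|k IH]; simpl; [lra|]. specialize (Hl k). lra. }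
  assert (Hexp : forall k, C + partial_sum l k <= C * exp (partial_sum d k / e)).
  { intros k. induction k as [|k IH]; simpl.
    - replace (0 / e) with 0 by (field; lra). rewrite exp_0. lra.
    - replace ((partial_sum d k + d k) / e) with (partial_sum d k / e + d k / e)
        by (field; lra).
      rewrite exp_plus, <- Rmult_assoc.
      apply Rle_trans with ((C + partial_sum l k) * (1 + d k / e)).
      + apply Rmult_le_reg_l with e; [assumption|].
        replace (e * ((C + partial_sum l k) * (1 + d k / e)))
          with (e * (C + partial_sum l k) + d k * (C + partial_sum l k)) by (field; lra).
        specialize (H k). lra.
      + apply Rle_trans with ((C + partial_sum l k) * exp (d k / e)).
        * apply Rmult_le_compat_l; [specialize (Hpos k); lra|apply exp_ineq1_le].
        * apply Rmult_le_compat_r; [left; apply exp_pos|assumption]. }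
  intros k. eapply Rle_trans; [apply Hexp|]. apply Rmult_le_compat_l; [lra|].
  assert (Hle : partial_sum d k / e <= D / e).
  { apply Rmult_le_compat_r; [left; now apply Rinv_0_lt_compat|apply HD]. }
  destruct Hle as [Hlt|Heq]; [left; now apply exp_increasing|rewrite Heq; lra].
Qed.

Section Convergence.
Context {X : NormedSpace}.
Implicit Types p q u v y z : X.
Hypothesis HB : complete X.
Variable phi : X -> R.
Hypothesis Hlip : locally_lipschitz phi.
Hypothesis HC : cerami phi.
Variable a : R.
Variable b : option R.
Hypothesis HKa : exists l : list X, forall u, m_phi phi u = 0 -> phi u = a -> In u l.
Hypothesis HKc : forall u, a < phi u -> lt_ext (phi u) b -> m_phi phi u <> 0.
Variables x w : nat -> X.
Hypothesis Hx : trajectory phi a x w.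

Lemma trajectory_decreasing j k : (j <= k)%nat -> phi (x k) <= phi (x j).
Proof.
  intros Hjk. induction Hjk as [|k Hjk IH]; [lra|].
  destruct (Hx k) as [Hw ->]. eapply Rle_trans; [|exact IH].
  replace (vadd (x k) (w k)) with (vadd (x k) (vscal 1 (w k))) by vec.
  apply (descent_step_le phi Hlip a); [assumption|lra].
Qed.

Lemma trajectory_above k : a < phi (x 0%nat) -> a < phi (x k).
Proof.
  intros H0. induction k as [|k IH]; [assumption|].
  destruct (Hx k) as [Hw ->].
  replace (vadd (x k) (w k)) with (vadd (x k) (vscal 1 (w k))) by vec.
  apply (descent_step_above phi a); [assumption|lra|assumption].
Qed.

Lemma trajectory_noncritical k : m_phi phi (x 0%nat) <> 0 -> m_phi phi (x k) <> 0.
Proof.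
  intros H0. induction k as [|k IH]; [assumption|].
  destruct (Hx k) as [Hw ->].
  replace (vadd (x k) (w k)) with (vadd (x k) (vscal 1 (w k))) by vec.
  apply (descent_step_noncritical phi Hlip a); [assumption|lra|assumption].
Qed.

Lemma trajectory_step_decrease k p v r l : descent_ball phi a p v r -> 0 < l ->
  vnorm (vsub (x k) p) + l < r -> w k = vscal l v ->
  phi (x (S k)) <= phi (x k) - l * (m_phi phi p / 2).
Proof.
  intros Hb Hl Hu Hw. destruct (Hx k) as [_ ->]. rewrite Hw.
  destruct (descent_ball_segment phi a p v r (x k) l 1 Hb Hl Hu ltac:(lra)) as [_ H].
  replace (vscal 1 (vscal l v)) with (vscal l v) in H by vec. lra.
Qed.

Definition cluster z : Prop :=
  forall eps N, eps > 0 -> exists k, (N <= k)%nat /\ vnorm (vsub (x k) z) < eps.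

Lemma cluster_phi_le z k : cluster z -> phi z <= phi (x k).
Proof.
  intros Hz. apply le_epsilon. intros e He.
  destruct (locally_lipschitz_continuous phi Hlip z e He) as [d [Hd Hc]].
  destruct (Hz d k Hd) as [j [Hj Hjz]]. specialize (Hc _ Hjz). apply Rabs_def2 in Hc.
  pose proof (trajectory_decreasing k j Hj). lra.
Qed.

Lemma cluster_phi_ge z : cluster z -> a < phi (x 0%nat) -> a <= phi z.
Proof.
  intros Hz Ha. apply le_epsilon. intros e He.
  destruct (locally_lipschitz_continuous phi Hlip z e He) as [d [Hd Hc]].
  destruct (Hz d 0%nat Hd) as [j [_ Hjz]]. specialize (Hc _ Hjz). apply Rabs_def2 in Hc.
  pose proof (trajectory_above j Ha). lra.
Qed.

(** If [phi z] is not below [b], the values along the orbit never drop below [b], where they start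
    at the highest. A nonzero step would lower them strictly, so the orbit is constant and [z] is
    its noncritical starting point. *)
Lemma cluster_noncritical z : cluster z -> m_phi phi (x 0%nat) <> 0 ->
  sublevel phi b (x 0%nat) -> a < phi z -> m_phi phi z <> 0.
Proof.
  intros Hz Hm0 Hb0 Haz.
  destruct (classic (lt_ext (phi z) b)) as [Hlt|Hlt]; [now apply HKc|].
  destruct b as [b'|]; simpl in *; [|tauto]. apply Rnot_lt_le in Hlt.
  assert (Hconst : forall k, x k = x 0%nat).
  { intros k. induction k as [|k IH]; [reflexivity|].
    destruct (Hx k) as [[Hw|(p & v & r & l & Hbl & Hl & Hu & Hw)] Heq].
    - rewrite Heq, Hw, vadd_0. exact IH.
    - exfalso. pose proof (trajectory_step_decrease k p v r l Hbl Hl Hu Hw).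
      pose proof (cluster_phi_le z (S k) Hz). rewrite IH in *.
      pose proof (m_phi_nonneg phi Hlip p). destruct Hbl as (_ & Hmp & _).
      assert (0 < l * (m_phi phi p / 2)) by (apply Rmult_lt_0_compat; lra). lra. }
  replace z with (x 0%nat); [assumption|]. apply vdist_eq0.
  apply Rle_antisym; [|apply vnorm_nonneg]. apply le_epsilon. intros e He.
  destruct (Hz e 0%nat He) as [k [_ Hk]]. rewrite Hconst in Hk. lra.
Qed.

(** The slope at [p] is at least [eps / (1 + vnorm p)], so length is paid for by decrease of [phi]
    up to a factor growing with the distance travelled. Gronwall bounds this factor, and
    completeness gives the limit. *)
Lemma steep_trajectory_converges N eps : eps > 0 -> a < phi (x 0%nat) ->
  (forall k p v r l, (N <= k)%nat -> descent_ball phi a p v r -> 0 < l ->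
     vnorm (vsub (x k) p) + l < r -> w k = vscal l v -> eps <= (1 + vnorm p) * m_phi phi p) ->
  exists z, tends x z.
Proof.
  intros He Ha Hsteep.
  pose (l := fun j => vnorm (w (N + j)%nat)).
  pose (d := fun j => phi (x (N + j)%nat) - phi (x (S (N + j)))).
  (* One unit comes from the Cerami weight, the other from the distance between [p] and the orbit
     point, which is below 1. *)
  pose (C := 2 + vnorm (x N)).
  assert (HC0 : 0 < C) by (unfold C; pose proof (vnorm_nonneg _ (x N)); lra).
  assert (Hd0 : forall j, 0 <= d j).
  { intros j. unfold d. pose proof (trajectory_decreasing (N + j) (S (N + j)) ltac:(lia)). lra. }
  assert (Hl0 : forall j, 0 <= l j) by (intros j; apply vnorm_nonneg).
  assert (Hnorm : forall j, vnorm (x (N + j)%nat) <= vnorm (x N) + partial_sum l j).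
  { intros j. induction j as [|j IH]; simpl.
    - rewrite Nat.add_0_r. lra.
    - rewrite Nat.add_succ_r. destruct (Hx (N + j)%nat) as [_ ->].
      eapply Rle_trans; [apply vnorm_triangle|]. change (vnorm (w (N + j)%nat)) with (l j). lra. }
  assert (Hslope : forall j, eps / 2 * l j <= d j * (C + partial_sum l j)).
  { intros j. specialize (Hnorm j). specialize (Hd0 j). unfold l at 1.
    destruct (Hx (N + j)%nat) as [[Hw|(p & v & r & t & Hb & Ht & Hu & Hw)] _].
    - rewrite Hw, vnorm_vzero. unfold C. pose proof (vnorm_nonneg _ (x (N + j)%nat)). nra.
    - specialize (Hsteep _ p v r t (Nat.le_add_r N j) Hb Ht Hu Hw).
      pose proof (trajectory_step_decrease _ p v r t Hb Ht Hu Hw) as Hdec.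
      assert (Hdj : t * (m_phi phi p / 2) <= d j) by (unfold d; lra).
      destruct Hb as (_ & _ & Hr & Hv & _).
      rewrite Hw, vnorm_scal_pos by lra.
      pose proof (vnorm_dist_le p (x (N + j)%nat)) as Hp. rewrite vdist_sym in Hp.
      assert (Hp' : 1 + vnorm p <= C + partial_sum l j) by (unfold C; lra).
      pose proof (vnorm_nonneg _ p). pose proof (vnorm_nonneg _ v).
      pose proof (m_phi_nonneg phi Hlip p).
      apply Rle_trans with (t * (m_phi phi p / 2) * (1 + vnorm p)).
      { assert (0 < t * (eps / 2)) by (apply Rmult_lt_0_compat; lra).
        apply Rle_trans with (t * (eps / 2)); [nra|].
        replace (t * (m_phi phi p / 2) * (1 + vnorm p))
          with (t * ((1 + vnorm p) * m_phi phi p / 2)) by field.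
        apply Rmult_le_compat_l; lra. }
      apply Rmult_le_compat; try lra. nra. }
  assert (Htel : forall j, partial_sum d j = phi (x N) - phi (x (N + j)%nat)).
  { intros j. induction j as [|j IH]; simpl.
    - rewrite Nat.add_0_r. ring.
    - rewrite IH. unfold d. rewrite Nat.add_succ_r. ring. }
  assert (HD : forall j, partial_sum d j <= phi (x N) - a).
  { intros j. rewrite Htel. pose proof (trajectory_above (N + j) Ha). lra. }
  pose proof (logarithmic_length_bound l d C (eps / 2) _ HC0 ltac:(lra) Hl0 HD Hslope) as Hlen.
  set (M := C * exp ((phi (x N) - a) / (eps / 2))) in Hlen.
  assert (HM : 0 < M) by (specialize (Hlen 0%nat); simpl in Hlen; lra).
  (* With the factor bounded by [M], distances are controlled linearly by decreases of [phi]; the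
     monotone bounded values then make the orbit Cauchy. *)
  assert (Hdist : forall i j, (i <= j)%nat -> eps / 2 * vnorm (vsub (x (N + j)%nat) (x (N + i)%nat))
     <= M * (phi (x (N + i)%nat) - phi (x (N + j)%nat))).
  { intros i j Hij. induction Hij as [|j Hij IH].
    - rewrite vdist_refl. lra.
    - pose proof (vdist_triangle (x (N + S j)%nat) (x (N + j)%nat) (x (N + i)%nat)) as Htri.
      rewrite Nat.add_succ_r in *. destruct (Hx (N + j)%nat) as [_ Heq].
      rewrite Heq, vdist_translate in Htri. rewrite <- Heq in Htri.
      specialize (Hslope j). specialize (Hlen j). specialize (Hd0 j).
      assert (eps / 2 * l j <= M * d j) by nra. unfold l, d in *. nra. }
  destruct (glb_exists (fun r => exists k, r = phi (x (N + k)%nat)) a) as [g [Hg1 Hg2]].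
  { exists (phi (x (N + 0)%nat)). now exists 0%nat. }
  { intros r [k ->]. left. now apply trajectory_above. }
  destruct (HB x) as [z Hz].
  - intros e He'. destruct (Hg2 (eps / 2 * e / (2 * M))) as [r [[k ->] Hk]].
    { apply Rdiv_lt_0_compat; nra. }
    exists (N + k)%nat.
    assert (Hclose : forall n, (n >= N + k)%nat -> vnorm (vsub (x n) (x (N + k)%nat)) < e / 2).
    { intros n Hn. replace n with (N + (n - N))%nat by lia.
      pose proof (Hdist k (n - N)%nat ltac:(lia)) as H1.
      pose proof (Hg1 _ (ex_intro _ (n - N)%nat eq_refl)) as H2.
      assert (H3 : M * (phi (x (N + k)%nat) - phi (x (N + (n - N))%nat)) < eps / 2 * e / 2).
      { apply (Rmult_lt_compat_l M) in Hk; [|assumption].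
        replace (M * (g + eps / 2 * e / (2 * M))) with (M * g + eps / 2 * e / 2) in Hk
          by (field; lra). nra. }
      apply Rmult_lt_reg_l with (eps / 2); [lra|]. lra. }
    intros n m Hn Hm. pose proof (Hclose n Hn). pose proof (Hclose m Hm).
    pose proof (vdist_triangle (x n) (x (N + k)%nat) (x m)) as Htri.
    rewrite (vdist_sym (x (N + k)%nat)) in Htri. lra.
  - exists z. now apply Un_cv_tends.
Qed.

(** If the weights of arbitrarily late steps come close to 0, the Cerami condition yields a critical
    cluster point, which [cluster_noncritical] forbids above [a]. Otherwise the orbit converges, and
    a limit above [a] would be noncritical, where the last hypothesis forces a fixed decrease
    infinitely often. *)
Lemma trajectory_cluster :
  a < phi (x 0%nat) -> m_phi phi (x 0%nat) <> 0 -> sublevel phi b (x 0%nat) ->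
  (forall q, a < phi q -> m_phi phi q <> 0 -> exists c delta, c > 0 /\ delta > 0 /\
     forall N, exists k, (N <= k)%nat /\
       (vnorm (vsub (x k) q) < delta -> phi (x (S k)) <= phi (x k) - c)) ->
  exists z, phi z = a /\ cluster z.
Proof.
  intros Ha Hm0 Hb0 Hstall.
  destruct (classic (forall N eps, eps > 0 -> exists k p v r l, (N <= k)%nat /\
    descent_ball phi a p v r /\ 0 < l /\ vnorm (vsub (x k) p) + l < r /\ w k = vscal l v /\
    (1 + vnorm p) * m_phi phi p < eps)) as [Hflat|Hsteep].
  - destruct (functional_choice_epsilon (fun (j : nat) (s : nat * X * X * R) =>
      let '(k, p, v, r) := s in (j <= k)%nat /\ descent_ball phi a p v r /\
        vnorm (vsub (x k) p) < r /\ (1 + vnorm p) * m_phi phi p < / INR (S j))) as [s Hs].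
    { intros j. destruct (Hflat j (/ INR (S j)) (inv_INR_S_pos j))
        as (k & p & v & r & l & Hk & Hb & Hl & Hu & _ & Hlt).
      exists (k, p, v, r). repeat split; try apply Hb; try assumption. lra. }
    pose (k := fun j => fst (fst (fst (s j)))). pose (p := fun j => snd (fst (fst (s j)))).
    pose (v := fun j => snd (fst (s j))). pose (r := fun j => snd (s j)).
    assert (Hs' : forall j, (j <= k j)%nat /\ descent_ball phi a (p j) (v j) (r j) /\
        vnorm (vsub (x (k j)) (p j)) < r j /\
        (1 + vnorm (p j)) * m_phi phi (p j) < / INR (S j)).
    { intros j. specialize (Hs j). unfold k, p, v, r.
      destruct (s j) as [[[k' p'] v'] r']. exact Hs. }
    destruct (cerami_descent_balls phi Hlip HC a p v (fun j => x (k j)) r)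
      as [sigma [q [Hsig [Hq Hlim]]]].
    + intros j. apply Hs'.
    + intros j. apply Hs'.
    + exists (Rabs a + 2 * (phi (x 0%nat) - a)). intros j.
      destruct (Hs' j) as (_ & (Hp & _ & _ & _ & _ & Hlev) & Hu & _). specialize (Hlev _ Hu).
      pose proof (trajectory_decreasing 0 (k j) ltac:(lia)).
      replace (phi (p j)) with (a + (phi (p j) - a)) by ring.
      eapply Rle_trans; [apply Rabs_triang|]. rewrite (Rabs_pos_eq (phi (p j) - a)); lra.
    + intros e He. destruct (inv_INR_S_small e He) as [N HN]. exists N. intros n Hn.
      specialize (HN n Hn). destruct (Hs' n) as (_ & _ & _ & Hlt).
      pose proof (vnorm_nonneg _ (p n)). pose proof (m_phi_nonneg phi Hlip (p n)).
      unfold Rdist. rewrite Rminus_0_r, Rabs_pos_eq; nra.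
    + assert (Hcl : cluster q).
      { intros e N He. destruct (Hlim e He) as [N' HN'].
        exists (k (sigma (N + N')%nat)). split; [|apply HN'; lia].
        pose proof (Hsig (N + N')%nat). destruct (Hs' (sigma (N + N')%nat)) as [Hk _]. lia. }
      exists q. split; [|assumption].
      destruct (cluster_phi_ge q Hcl Ha) as [Hlt|Heq]; [|easy].
      exfalso. now apply (cluster_noncritical q).
  - assert (Hex : exists N eps, eps > 0 /\ forall k p v r l, (N <= k)%nat ->
      descent_ball phi a p v r -> 0 < l -> vnorm (vsub (x k) p) + l < r -> w k = vscal l v ->
      eps <= (1 + vnorm p) * m_phi phi p).
    { apply NNPP. intros Hn. apply Hsteep. intros N eps He. apply NNPP. intros Hn'. apply Hn.
      exists N, eps. split; [assumption|]. intros k p v r l Hk Hb Hl Hu Hw.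
      apply Rnot_lt_le. intros Hlt. apply Hn'. now exists k, p, v, r, l. }
    destruct Hex as (N & eps & He & H).
    destruct (steep_trajectory_converges N eps He Ha H) as [z Hz].
    assert (Hcl : cluster z).
    { intros e N' He'. destruct (Hz e He') as [N'' HN'']. exists (N' + N'')%nat.
      split; [lia|]. apply HN''. lia. }
    exists z. split; [|assumption].
    destruct (cluster_phi_ge z Hcl Ha) as [Hlt|Heq]; [exfalso|easy].
    destruct (Hstall z Hlt (cluster_noncritical z Hcl Hm0 Hb0 Hlt))
      as (c & delta & Hc & Hdelta & Hdec).
    destruct (Hz delta Hdelta) as [N1 HN1].
    destruct (tends_phi phi Hlip x z Hz c Hc) as [N2 HN2].
    destruct (Hdec (N1 + N2)%nat) as [k [Hk Hdk]].
    specialize (Hdk (HN1 k ltac:(lia))). specialize (HN2 k ltac:(lia)). apply Rabs_def2 in HN2.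
    pose proof (cluster_phi_le z (S k) Hcl). lra.
Qed.

(** Once the orbit comes close enough to its cluster point, the trap keeps it close. *)
Lemma trajectory_converges :
  a < phi (x 0%nat) -> m_phi phi (x 0%nat) <> 0 -> sublevel phi b (x 0%nat) ->
  (forall q, a < phi q -> m_phi phi q <> 0 -> exists c delta, c > 0 /\ delta > 0 /\
     forall N, exists k, (N <= k)%nat /\
       (vnorm (vsub (x k) q) < delta -> phi (x (S k)) <= phi (x k) - c)) ->
  exists z, phi z = a /\ tends x z.
Proof.
  intros Ha Hm0 Hb0 Hstall.
  destruct (trajectory_cluster Ha Hm0 Hb0 Hstall) as [z [Hz Hcl]].
  exists z. split; [assumption|]. intros eps He.
  destruct (trajectory_trapped phi Hlip HC a HKa z eps Hz He) as [delta [Hd Htrap]].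
  destruct (Hcl delta 0%nat Hd) as [K [_ HK]].
  exists K. intros n Hn.
  replace (x n) with (vadd (x n) (vscal 0 (w n))) by vec.
  apply (Htrap x w K Hx HK (trajectory_above K Ha) n 0); [assumption|lra].
Qed.
End Convergence.

(** * The discrete descent fields *)

Definition scale (n : nat) : R := (/ 2) ^ n.

Lemma scale_pos n : 0 < scale n.
Proof. apply pow_lt. lra. Qed.

Lemma scale_small eps : eps > 0 -> exists n, scale n < eps.
Proof.
  intros He. destruct (pow_lt_1_zero (/ 2)) with (y := eps) as [N HN].
  - rewrite Rabs_pos_eq; lra.
  - assumption.
  - exists N. specialize (HN N (le_n N)).
    rewrite Rabs_pos_eq in HN; [assumption|]. left. apply scale_pos.
Qed.

Section Fields.
Context {X : NormedSpace}.
Implicit Types p q u v w z : X.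
Variable phi : X -> R.
Hypothesis Hlip : locally_lipschitz phi.
Variable a : R.
Variable lt : X -> X -> Prop.
Hypothesis lt_total : forall x y : X, x <> y -> lt x y \/ lt y x.
Hypothesis lt_wf : forall P : X -> Prop, (exists x, P x) ->
  exists x, P x /\ forall y, P y -> ~ lt y x.
Variables (dir : X -> X) (rad : X -> R).
Hypothesis Hball : forall p, descent_ball phi a p (dir p) (rad p) \/ rad p = 0.
Hypothesis Hgood : forall p, a < phi p -> m_phi phi p <> 0 ->
  descent_ball phi a p (dir p) (rad p).

Definition bump p u : R := Rmax 0 (rad p - vnorm (vsub u p)).

(** Measures how deeply [u] lies in balls whose centres precede [p]; the value 0 keeps the supremum
    defined when there are none. *)
Definition prior p u : R :=
  epsilon (inhabits 0) (is_lub (fun r => r = 0 \/ exists q, lt q p /\ r = bump q u)).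

(** Positive where [u] is deeper than three scales in the ball of [p] but less than two in every
    earlier ball. The gap of one scale separates the supports, and the subtracted [3 * scale n]
    leaves room for a step of length [psi n p u]. *)
Definition psi (n : nat) p u : R :=
  Rmin (Rmax 0 (bump p u - 3 * scale n)) (Rmax 0 (2 * scale n - prior p u)).

(* At scale [n] the supports of the [psi n p] are [scale n] apart, so at most one [p]
   contributes near a given point. *)
Definition field (n : nat) u : X :=
  let p := epsilon (inhabits u) (fun p => 0 < psi n p u) in vscal (psi n p u) (dir p).

Lemma rad_le_1 p : rad p <= 1.
Proof. destruct (Hball p) as [(_ & _ & H & _)|H]; lra. Qed.

Lemma bump_le_1 p u : bump p u <= 1.
Proof.
  pose proof (rad_le_1 p). pose proof (vnorm_nonneg _ (vsub u p)).
  apply Rmax_lub; lra.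
Qed.

Lemma bump_lipschitz p u w : bump p u <= bump p w + vnorm (vsub u w).
Proof.
  pose proof (vdist_triangle w u p) as H. rewrite (vdist_sym w u) in H.
  pose proof (vnorm_nonneg _ (vsub u w)). unfold bump.
  pose proof (Rmax_l 0 (rad p - vnorm (vsub w p))).
  pose proof (Rmax_r 0 (rad p - vnorm (vsub w p))). apply Rmax_lub; lra.
Qed.

Lemma bump_pos_ball p u : 0 < bump p u ->
  descent_ball phi a p (dir p) (rad p) /\ bump p u = rad p - vnorm (vsub u p).
Proof.
  unfold bump. pose proof (vnorm_nonneg _ (vsub u p)).
  destruct (Rle_dec 0 (rad p - vnorm (vsub u p))) as [Hle|Hle].
  - rewrite Rmax_right by assumption. intros Hp. split; [|reflexivity].
    destruct (Hball p) as [Hb|Hr]; [assumption|lra].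
  - rewrite Rmax_left; lra.
Qed.

Lemma prior_lub p u :
  is_lub (fun r => r = 0 \/ exists q, lt q p /\ r = bump q u) (prior p u).
Proof.
  unfold prior. apply epsilon_spec.
  destruct (completeness (fun r => r = 0 \/ exists q, lt q p /\ r = bump q u)) as [l Hl].
  - exists 1. intros r [ -> |[q [_ ->]]]; [lra|apply bump_le_1].
  - exists 0. now left.
  - now exists l.
Qed.

Lemma prior_lipschitz p u w : prior p u <= prior p w + vnorm (vsub u w).
Proof.
  pose proof (vnorm_nonneg _ (vsub u w)). destruct (prior_lub p w) as [Hub _].
  apply (proj2 (prior_lub p u)). intros r [ -> |[q [Hq ->]]].
  - assert (0 <= prior p w) by (apply Hub; now left). lra.
  - assert (bump q w <= prior p w) by (apply Hub; right; now exists q).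
    pose proof (bump_lipschitz q u w). lra.
Qed.

Lemma psi_nonneg n p u : 0 <= psi n p u.
Proof. apply Rmin_glb; apply Rmax_l. Qed.

Lemma psi_lipschitz n p u w : psi n p u <= psi n p w + vnorm (vsub u w).
Proof.
  pose proof (vnorm_nonneg _ (vsub u w)).
  pose proof (bump_lipschitz p u w). pose proof (prior_lipschitz p w u) as Hp.
  rewrite vdist_sym in Hp. unfold psi.
  set (A := Rmax 0 (bump p w - 3 * scale n)). set (B := Rmax 0 (2 * scale n - prior p w)).
  assert (Rmax 0 (bump p u - 3 * scale n) <= A + vnorm (vsub u w)).
  { pose proof (Rmax_l 0 (bump p w - 3 * scale n)).
    pose proof (Rmax_r 0 (bump p w - 3 * scale n)). apply Rmax_lub; unfold A; lra. }
  assert (Rmax 0 (2 * scale n - prior p u) <= B + vnorm (vsub u w)).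
  { pose proof (Rmax_l 0 (2 * scale n - prior p w)).
    pose proof (Rmax_r 0 (2 * scale n - prior p w)). apply Rmax_lub; unfold B; lra. }
  pose proof (Rmin_l (Rmax 0 (bump p u - 3 * scale n)) (Rmax 0 (2 * scale n - prior p u))).
  pose proof (Rmin_r (Rmax 0 (bump p u - 3 * scale n)) (Rmax 0 (2 * scale n - prior p u))).
  apply (Rmin_case A B (fun m => _ <= m + vnorm (vsub u w))); lra.
Qed.

Lemma psi_pos n p u : 0 < psi n p u ->
  psi n p u <= bump p u - 3 * scale n /\ prior p u < 2 * scale n.
Proof.
  unfold psi. intros H.
  pose proof (Rmin_l (Rmax 0 (bump p u - 3 * scale n)) (Rmax 0 (2 * scale n - prior p u))).
  pose proof (Rmin_r (Rmax 0 (bump p u - 3 * scale n)) (Rmax 0 (2 * scale n - prior p u))).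
  split.
  - destruct (Rle_dec 0 (bump p u - 3 * scale n));
      [rewrite (Rmax_right 0 (bump p u - _)) in * by lra|
       rewrite (Rmax_left 0 (bump p u - _)) in * by lra]; lra.
  - destruct (Rle_dec 0 (2 * scale n - prior p u));
      [|rewrite (Rmax_left 0 (2 * scale n - _)) in * by lra; lra].
    rewrite (Rmax_right 0 (2 * scale n - _)) in * by lra; lra.
Qed.

(** If [p] precedes [q], the bump of [p] exceeds [3 * scale n] at [u] and is below [2 * scale n] at
    [w]; being 1-Lipschitz, it forces the points apart. *)
Lemma psi_disjoint n p q u w : 0 < psi n p u -> 0 < psi n q w ->
  vnorm (vsub u w) < scale n -> p = q.
Proof.
  intros Hp Hq Huw. pose proof (psi_pos _ _ _ Hp). pose proof (psi_pos _ _ _ Hq).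
  apply NNPP. intros Hne. destruct (lt_total p q Hne) as [Hlt|Hlt].
  - assert (bump p w <= prior q w) by (apply prior_lub; right; now exists p).
    pose proof (bump_lipschitz p u w). lra.
  - assert (bump q u <= prior p u) by (apply prior_lub; right; now exists q).
    pose proof (bump_lipschitz q w u) as Hb. rewrite vdist_sym in Hb. lra.
Qed.

Lemma field_eq n p u : 0 < psi n p u -> field n u = vscal (psi n p u) (dir p).
Proof.
  intros Hp. unfold field.
  assert (H : 0 < psi n (epsilon (inhabits u) (fun p => 0 < psi n p u)) u).
  { apply (epsilon_spec (inhabits u) (fun p => 0 < psi n p u)). now exists p. }
  cbv zeta. set (q := epsilon (inhabits u) (fun p => 0 < psi n p u)) in *.
  replace q with p; [reflexivity|]. apply (psi_disjoint n p q u u Hp H).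
  rewrite vdist_refl. apply scale_pos.
Qed.

Lemma field_none n u : (forall p, ~ 0 < psi n p u) -> field n u = vzero.
Proof.
  intros H. unfold field. cbv zeta. set (q := epsilon _ _).
  replace (psi n q u) with 0; [apply vscal_0|].
  pose proof (psi_nonneg n q u). specialize (H q). lra.
Qed.

Lemma field_cases n u :
  (forall p, ~ 0 < psi n p u) \/ exists p, 0 < psi n p u.
Proof.
  destruct (classic (exists p, 0 < psi n p u)) as [H|H]; [now right|left].
  intros p Hp. apply H. now exists p.
Qed.

Lemma psi_pos_ball n p u : 0 < psi n p u ->
  descent_ball phi a p (dir p) (rad p) /\ vnorm (vsub u p) + psi n p u < rad p.
Proof.
  intros Hp. pose proof (psi_pos _ _ _ Hp). pose proof (scale_pos n).
  destruct (bump_pos_ball p u) as [Hb He]; [lra|]. split; [assumption|lra].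
Qed.

Lemma field_descent_step n u : descent_step phi a u (field n u).
Proof.
  destruct (field_cases n u) as [H|[p Hp]].
  - left. now apply field_none.
  - right. destruct (psi_pos_ball n p u Hp) as [Hb He].
    exists p, (dir p), (rad p), (psi n p u). repeat split; try apply Hb; try assumption.
    now apply field_eq.
Qed.

(** At this distance a single centre serves both points, so the two values are multiples of one
    vector of norm at most 1 with 1-Lipschitz coefficients. *)
Lemma field_nonexpansive n u w : vnorm (vsub u w) < scale n ->
  vnorm (vsub (field n u) (field n w)) <= vnorm (vsub u w).
Proof.
  intros Huw.
  assert (Hboth : (exists p, vnorm (dir p) <= 1 /\ field n u = vscal (psi n p u) (dir p) /\
      field n w = vscal (psi n p w) (dir p)) \/ (field n u = vzero /\ field n w = vzero)).
  { assert (Hother : forall p u w, vnorm (vsub u w) < scale n -> 0 < psi n p u ->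
      field n w = vscal (psi n p w) (dir p)).
    { intros p u' w' Hd Hp. destruct (psi_nonneg n p w') as [Hw|Hw]; [now apply field_eq|].
      rewrite <- Hw, vscal_0. apply field_none. intros q Hq.
      pose proof (psi_disjoint n p q u' w' Hp Hq Hd). subst q. lra. }
    destruct (field_cases n u) as [Hu|[p Hp]].
    - destruct (field_cases n w) as [Hw|[p Hp]].
      + right. split; now apply field_none.
      + left. exists p. split; [apply (psi_pos_ball n p w Hp)|]. split; [|now apply field_eq].
        apply (Hother p w u); [now rewrite vdist_sym|assumption].
    - left. exists p. split; [apply (psi_pos_ball n p u Hp)|]. split; [now apply field_eq|].
      now apply (Hother p u w). }
  pose proof (vnorm_nonneg _ (vsub u w)).
  destruct Hboth as [(p & Hd & -> & ->)|[-> ->]].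
  - replace (vsub (vscal (psi n p u) (dir p)) (vscal (psi n p w) (dir p)))
      with (vscal (psi n p u - psi n p w) (dir p)) by vec.
    rewrite vnorm_scal.
    assert (Rabs (psi n p u - psi n p w) <= vnorm (vsub u w)).
    { apply Rabs_le. pose proof (psi_lipschitz n p u w).
      pose proof (psi_lipschitz n p w u) as H'. rewrite vdist_sym in H'. lra. }
    pose proof (Rabs_pos (psi n p u - psi n p w)). pose proof (vnorm_nonneg _ (dir p)). nra.
  - rewrite vdist_refl. assumption.
Qed.

Lemma field_below n u : phi u <= a -> field n u = vzero.
Proof.
  intros Hu. destruct (field_descent_step n u) as [H|(p & v & r & l & Hb & Hl & Hd & _)];
    [assumption|].
  pose proof (descent_ball_above phi a p v r u Hb ltac:(lra)). lra.
Qed.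

(** Take the least [p] whose ball contains [q]. No earlier bump is positive at [q], so [psi n p q]
    is positive once [4 * scale n < bump p q]. *)
Lemma field_no_stall q : a < phi q -> m_phi phi q <> 0 ->
  exists n c delta, c > 0 /\ delta > 0 /\
    forall u, vnorm (vsub u q) < delta -> phi (vadd u (field n u)) <= phi u - c.
Proof.
  intros Hq Hm. destruct (lt_wf (fun p => 0 < bump p q)) as [p [Hp Hmin]].
  { exists q. unfold bump. rewrite vdist_refl, Rminus_0_r.
    destruct (Hgood q Hq Hm) as (_ & _ & Hr & _). rewrite Rmax_right; lra. }
  destruct (scale_small (bump p q / 4)) as [n Hn]; [lra|].
  assert (Hprior : prior p q <= 0).
  { apply prior_lub. intros r [ -> |[p' [Hp' ->]]]; [lra|].
    apply Rnot_lt_le. intros Hlt. exact (Hmin p' Hlt Hp'). }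
  pose proof (scale_pos n) as Hsn.
  assert (Hpsi : 0 < psi n p q).
  { apply Rmin_glb_lt; [eapply Rlt_le_trans; [|apply Rmax_r]; lra|].
    eapply Rlt_le_trans; [|apply Rmax_r]; lra. }
  destruct (psi_pos_ball n p q Hpsi) as [Hb _].
  assert (Hmp : 0 < m_phi phi p).
  { destruct Hb as (_ & Hmp & _). pose proof (m_phi_nonneg phi Hlip p). lra. }
  (* Since [psi n p] is 1-Lipschitz, it keeps at least half of its value on this ball. *)
  exists n, (psi n p q / 2 * (m_phi phi p / 2)), (psi n p q / 2).
  split; [apply Rmult_lt_0_compat; lra|]. split; [lra|].
  intros u Hu. pose proof (psi_lipschitz n p q u) as Hl. rewrite vdist_sym in Hl.
  assert (Hpu : 0 < psi n p u) by lra.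
  destruct (psi_pos_ball n p u Hpu) as [_ Hd].
  rewrite (field_eq n p u Hpu).
  destruct (descent_ball_segment phi a _ _ _ u _ 1 Hb Hpu Hd ltac:(lra)) as [_ H].
  rewrite vscal_1 in H. nra.
Qed.

(* Every scale is used infinitely often. *)
Definition schedule (k : nat) : nat := fst (of_nat k).

Fixpoint iter_field u (k : nat) : X :=
  match k with
  | O => u
  | S k => vadd (iter_field u k) (field (schedule k) (iter_field u k))
  end.

Definition increment u (k : nat) : X := field (schedule k) (iter_field u k).

Lemma iter_field_trajectory u : trajectory phi a (iter_field u) (increment u).
Proof. intros k. split; [apply field_descent_step|reflexivity]. Qed.

Lemma iter_field_no_stall u q : a < phi q -> m_phi phi q <> 0 ->
  exists c delta, c > 0 /\ delta > 0 /\ forall N, exists k, (N <= k)%nat /\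
    (vnorm (vsub (iter_field u k) q) < delta ->
     phi (iter_field u (S k)) <= phi (iter_field u k) - c).
Proof.
  intros Hq Hm. destruct (field_no_stall q Hq Hm) as (n & c & delta & Hc & Hd & H).
  exists c, delta. repeat split; try assumption. intros N.
  assert (Hk : exists k, (N <= k)%nat /\ schedule k = n).
  { exists (to_nat (n, N)). unfold schedule. rewrite cancel_of_to.
    pose proof (to_nat_non_decreasing n N). split; [lia|reflexivity]. }
  destruct Hk as [k [HNk Hkn]]. exists k. split; [assumption|].
  intros Hk. simpl. rewrite Hkn. now apply H.
Qed.

Lemma iter_field_below u k : phi u <= a -> iter_field u k = u.
Proof.
  intros Hu. induction k as [|k IH]; [reflexivity|].
  simpl. rewrite IH, field_below by assumption. apply vadd_0.
Qed.

Lemma iter_field_continuous k u eps : eps > 0 -> exists delta, delta > 0 /\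
  forall w, vnorm (vsub w u) < delta -> vnorm (vsub (iter_field w k) (iter_field u k)) < eps.
Proof.
  revert eps. induction k as [|k IH]; intros eps He.
  - exists eps. split; [assumption|]. auto.
  - pose proof (scale_pos (schedule k)) as Hs.
    (* Within the scale, the step at most doubles the distance. *)
    destruct (IH (Rmin (scale (schedule k)) (eps / 2))) as [d [Hd H]];
      [apply Rmin_pos; lra|].
    exists d. split; [assumption|]. intros w Hw. specialize (H w Hw).
    pose proof (Rmin_l (scale (schedule k)) (eps / 2)).
    pose proof (Rmin_r (scale (schedule k)) (eps / 2)).
    simpl. set (x := iter_field w k) in *. set (y := iter_field u k) in *.
    pose proof (field_nonexpansive (schedule k) x y ltac:(lra)).
    replace (vsub (vadd x (field (schedule k) x)) (vadd y (field (schedule k) y)))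
      with (vadd (vsub x y) (vsub (field (schedule k) x) (field (schedule k) y))) by vec.
    eapply Rle_lt_trans; [apply vnorm_triangle|]. lra.
Qed.

Lemma increment_continuous k u eps : eps > 0 -> exists delta, delta > 0 /\
  forall w, vnorm (vsub w u) < delta -> vnorm (vsub (increment w k) (increment u k)) < eps.
Proof.
  intros He. pose proof (scale_pos (schedule k)) as Hs.
  destruct (iter_field_continuous k u (Rmin (scale (schedule k)) eps)) as [d [Hd H]];
    [apply Rmin_pos; lra|].
  exists d. split; [assumption|]. intros w Hw. specialize (H w Hw).
  pose proof (Rmin_l (scale (schedule k)) eps). pose proof (Rmin_r (scale (schedule k)) eps).
  unfold increment.
  pose proof (field_nonexpansive (schedule k) (iter_field w k) (iter_field u k) ltac:(lra)). lra.
Qed.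

(** * Interpolation in time *)

(* The [k]-th increment is performed during the time interval [1 - 2^-k, 1 - 2^-(k+1)]. *)
Definition progress (k : nat) (t : R) : R := Rmax 0 (Rmin 1 (2 - 2 ^ S k * (1 - t))).

Fixpoint path (k : nat) (t : R) u : X :=
  match k with
  | O => u
  | S k => vadd (path k t u) (vscal (progress k t) (increment u k))
  end.

(** For [t < 1] the sequence of paths is eventually constant; at [t = 1] it is the orbit itself.
    Where there is no limit the value is arbitrary. *)
Definition deformation (t : R) u : X :=
  epsilon (inhabits u) (tends (fun k => path k t u)).

Lemma progress_range k t : 0 <= progress k t <= 1.
Proof.
  split; [apply Rmax_l|]. apply Rmax_lub; [lra|apply Rmin_l].
Qed.

Lemma progress_one k t : 2 ^ S k * (1 - t) <= 1 -> progress k t = 1.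
Proof. intros H. unfold progress. rewrite Rmin_left, Rmax_right; lra. Qed.

Lemma progress_zero k t : 1 <= 2 ^ k * (1 - t) -> progress k t = 0.
Proof.
  intros H. unfold progress. apply Rmax_left.
  eapply Rle_trans; [apply Rmin_r|]. simpl. lra.
Qed.

Lemma pow2_mono i j s : 0 <= s -> (i <= j)%nat -> 2 ^ i * s <= 2 ^ j * s.
Proof. intros Hs Hij. apply Rmult_le_compat_r; [assumption|]. apply Rle_pow; [lra|assumption]. Qed.

Lemma progress_zero_from K t : t <= 1 -> 1 <= 2 ^ K * (1 - t) ->
  forall i, (K <= i)%nat -> progress i t = 0.
Proof.
  intros Ht HK i Hi. apply progress_zero.
  eapply Rle_trans; [exact HK|]. apply pow2_mono; [lra|assumption].
Qed.

(** Increments are performed one after another: none begins before the previous ones are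
    complete. *)
Lemma progress_lt_1 k t i : t <= 1 -> progress k t < 1 -> (k < i)%nat -> progress i t = 0.
Proof.
  intros Ht Hk Hi. apply (progress_zero_from (S k)); [assumption| |assumption].
  apply Rnot_lt_le. intros Hlt. rewrite progress_one in Hk; lra.
Qed.

Lemma progress_lipschitz k s t : Rabs (progress k s - progress k t) <= 2 ^ S k * Rabs (s - t).
Proof.
  assert (Hp : 0 < 2 ^ S k) by (apply pow_lt; lra).
  assert (H : forall s t, progress k s <= progress k t + 2 ^ S k * Rabs (s - t)).
  { intros s' t'. unfold progress.
    pose proof (Rle_abs (s' - t')). pose proof (Rabs_pos (s' - t')).
    assert (Hd : 2 ^ S k * (s' - t') <= 2 ^ S k * Rabs (s' - t'))
      by (apply Rmult_le_compat_l; lra).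
    assert (Hd0 : 0 <= 2 ^ S k * Rabs (s' - t')) by (apply Rmult_le_pos; lra).
    set (M := 2 ^ S k) in *.
    pose proof (Rmax_l 0 (Rmin 1 (2 - M * (1 - t')))).
    pose proof (Rmax_r 0 (Rmin 1 (2 - M * (1 - t')))).
    apply Rmax_lub; [lra|].
    pose proof (Rmin_l 1 (2 - M * (1 - s'))). pose proof (Rmin_r 1 (2 - M * (1 - s'))).
    destruct (Rle_dec 1 (2 - M * (1 - t')));
      [rewrite (Rmin_left 1 (2 - M * (1 - t'))) in * by lra|
       rewrite (Rmin_right 1 (2 - M * (1 - t'))) in * by lra]; nra. }
  apply Rabs_le. pose proof (H s t). pose proof (H t s) as H'.
  rewrite (Rabs_minus_sym t s) in H'. lra.
Qed.

Lemma path_full k t u : (forall i, (i < k)%nat -> progress i t = 1) -> path k t u = iter_field u k.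
Proof.
  intros H. induction k as [|k IH]; [reflexivity|].
  simpl. rewrite IH, (H k) by (auto with arith). now rewrite vscal_1.
Qed.

Lemma path_stationary K m t u : (forall i, (K <= i)%nat -> progress i t = 0) ->
  (K <= m)%nat -> path m t u = path K t u.
Proof.
  intros H Hm. induction Hm as [|m Hm IH]; [reflexivity|].
  simpl. now rewrite IH, (H m Hm), vscal_0, vadd_0.
Qed.

(** A path always stands on a single segment of the polygonal orbit, so estimates for one descent
    step apply to it. The bound [K <= j] records that the first [K] segments are already behind. *)
Lemma path_shape K m t u : t <= 1 -> (forall i, (i < K)%nat -> progress i t = 1) ->
  (K <= m)%nat -> exists j s, (K <= j)%nat /\ 0 <= s <= 1 /\
    path m t u = vadd (iter_field u j) (vscal s (increment u j)).
Proof.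
  intros Ht HK Hm.
  assert (H : (forall i, (i < m)%nat -> progress i t = 1) \/
    exists j, (K <= j < m)%nat /\ progress j t < 1 /\
      path m t u = vadd (iter_field u j) (vscal (progress j t) (increment u j))).
  { induction Hm as [|m Hm IH]; [now left|].
    destruct IH as [IH|(j & Hj & Hp & IH)].
    - destruct (proj2 (progress_range m t)) as [Hlt|Heq].
      + right. exists m. split; [lia|]. split; [assumption|].
        simpl. now rewrite path_full.
      + left. intros i Hi. destruct (Nat.eq_dec i m) as [->|Hne]; [assumption|].
        apply IH. lia.
    - right. exists j. split; [lia|]. split; [assumption|].
      simpl. rewrite (progress_lt_1 j t m Ht Hp) by lia.
      now rewrite vscal_0, vadd_0. }
  destruct H as [H|(j & Hj & _ & H)].
  - exists m, 0. split; [assumption|]. split; [lra|].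
    rewrite path_full by assumption. now rewrite vscal_0, vadd_0.
  - exists j, (progress j t). split; [lia|]. split; [apply progress_range|assumption].
Qed.

Lemma path_continuous k t u eps : eps > 0 -> exists delta, delta > 0 /\
  forall s w, Rabs (s - t) < delta -> vnorm (vsub w u) < delta ->
    vnorm (vsub (path k s w) (path k t u)) < eps.
Proof.
  revert eps. induction k as [|k IH]; intros eps He.
  - exists eps. split; [assumption|]. auto.
  - destruct (IH (eps / 3)) as [d1 [Hd1 H1]]; [lra|].
    destruct (increment_continuous k u (eps / 3)) as [d2 [Hd2 H2]]; [lra|].
    set (M := 2 ^ S k). assert (HM : 0 < M) by (apply pow_lt; lra).
    set (D := vnorm (increment u k)). assert (HD : 0 <= D) by apply vnorm_nonneg.
    assert (HMD : 0 < M * (D + 1)) by (apply Rmult_lt_0_compat; lra).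
    (* [M] is the Lipschitz constant of [progress k] in time and [D] the length of the increment;
       [D + 1] avoids division by zero. *)
    set (d3 := eps / 3 / (M * (D + 1))).
    assert (Hd3 : 0 < d3) by (apply Rdiv_lt_0_compat; lra).
    exists (Rmin d1 (Rmin d2 d3)). split; [repeat apply Rmin_pos; assumption|].
    intros s w Hs Hw.
    pose proof (Rmin_l d1 (Rmin d2 d3)). pose proof (Rmin_r d1 (Rmin d2 d3)).
    pose proof (Rmin_l d2 d3). pose proof (Rmin_r d2 d3).
    specialize (H1 s w ltac:(lra) ltac:(lra)). specialize (H2 w ltac:(lra)).
    simpl. set (x := path k s w) in *. set (y := path k t u) in *.
    set (e := increment w k) in *. set (f := increment u k) in *.
    replace (vsub (vadd x (vscal (progress k s) e)) (vadd y (vscal (progress k t) f)))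
      with (vadd (vsub x y) (vadd (vscal (progress k s) (vsub e f))
        (vscal (progress k s - progress k t) f))) by vec.
    eapply Rle_lt_trans; [apply vnorm_triangle|].
    pose proof (vnorm_triangle _ (vscal (progress k s) (vsub e f))
        (vscal (progress k s - progress k t) f)) as Htri.
    destruct (progress_range k s) as [Hp0 Hp1].
    rewrite (vnorm_scal_pos (progress k s)), (vnorm_scal _ (progress k s - progress k t)) in Htri
      by assumption.
    pose proof (progress_lipschitz k s t) as Hpl. fold M in Hpl. fold D in Htri.
    assert (Hb1 : progress k s * vnorm (vsub e f) <= eps / 3).
    { pose proof (vnorm_nonneg _ (vsub e f)). nra. }
    assert (Hb2 : Rabs (progress k s - progress k t) * D <= eps / 3).
    { apply Rle_trans with (M * d3 * (D + 1)).
      - pose proof (Rabs_pos (progress k s - progress k t)).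
        pose proof (Rabs_pos (s - t)). apply Rmult_le_compat; try lra. nra.
      - right. unfold d3. field. lra. }
    lra.
Qed.

Lemma tends_unique (x : nat -> X) z z' : tends x z -> tends x z' -> z = z'.
Proof.
  intros H H'. apply vdist_eq0. apply Rle_antisym; [|apply vnorm_nonneg].
  apply le_epsilon. intros e He.
  destruct (H (e / 2)) as [N HN]; [lra|]. destruct (H' (e / 2)) as [N' HN']; [lra|].
  specialize (HN (N + N')%nat ltac:(lia)). specialize (HN' (N + N')%nat ltac:(lia)).
  pose proof (vdist_triangle z (x (N + N')%nat) z') as Htri.
  rewrite (vdist_sym z (x _)) in Htri. lra.
Qed.

Lemma deformation_eq t u z : tends (fun k => path k t u) z -> deformation t u = z.
Proof.
  intros H. apply (tends_unique (fun k => path k t u)); [|assumption].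
  unfold deformation. apply epsilon_spec. now exists z.
Qed.

Lemma deformation_path K t u : t <= 1 -> 1 <= 2 ^ K * (1 - t) -> deformation t u = path K t u.
Proof.
  intros Ht HK. apply deformation_eq. intros e He. exists K. intros m Hm.
  rewrite (path_stationary K m t u (progress_zero_from K t Ht HK) Hm), vdist_refl. lra.
Qed.

Lemma pow2_unbounded s : 0 < s -> exists K, 1 < 2 ^ K * s.
Proof.
  intros Hs. destruct (Pow_x_infinity 2) with (b := 2 / s) as [K HK].
  - rewrite Rabs_pos_eq; lra.
  - exists K. specialize (HK K (le_n K)).
    rewrite Rabs_pos_eq in HK by (apply pow_le; lra).
    apply Rge_le, (Rmult_le_compat_r s) in HK; [|lra].
    replace (2 / s * s) with 2 in HK by (field; lra). lra.
Qed.

Lemma deformation_shape t u : t < 1 -> exists j s, 0 <= s <= 1 /\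
  deformation t u = vadd (iter_field u j) (vscal s (increment u j)).
Proof.
  intros Ht. destruct (pow2_unbounded (1 - t)) as [K HK]; [lra|].
  rewrite (deformation_path K) by lra.
  destruct (path_shape 0 K t u) as (j & s & _ & Hs & H); [lra|lia|lia|]. now exists j, s.
Qed.

Lemma path_at_1 k u : path k 1 u = iter_field u k.
Proof. apply path_full. intros i _. apply progress_one. rewrite Rminus_diag. lra. Qed.

Lemma deformation_below t u : phi u <= a -> deformation t u = u.
Proof.
  intros Hu. apply deformation_eq. intros e He. exists 0%nat. intros n _.
  replace (path n t u) with u; [rewrite vdist_refl; lra|].
  induction n as [|n IH]; [reflexivity|].
  simpl. rewrite <- IH. unfold increment. rewrite iter_field_below, field_below by assumption.
  vec.
Qed.

Lemma deformation_at_0 u : deformation 0 u = u.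
Proof. rewrite (deformation_path 0) by (simpl; lra). reflexivity. Qed.

Lemma deformation_continuous_before_1 t u eps : t < 1 -> eps > 0 -> exists delta, delta > 0 /\
  forall s w, s <= 1 -> Rabs (s - t) < delta -> vnorm (vsub w u) < delta ->
    vnorm (vsub (deformation s w) (deformation t u)) < eps.
Proof.
  (* Halving [1 - t] makes the same [K] valid for all times near [t], so the deformation is there
     the finite path [path K]. *)
  intros Ht He. destruct (pow2_unbounded ((1 - t) / 2)) as [K HK]; [lra|].
  destruct (path_continuous K t u eps He) as [d [Hd H]].
  assert (HP : 0 < 2 ^ K) by (apply pow_lt; lra).
  exists (Rmin d ((1 - t) / 2)). split; [apply Rmin_pos; lra|].
  intros s w Hs1 Hs Hw. pose proof (Rmin_l d ((1 - t) / 2)). pose proof (Rmin_r d ((1 - t) / 2)).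
  assert (Hs2 : (1 - t) / 2 < 1 - s).
  { assert (Hs' : Rabs (s - t) < (1 - t) / 2) by lra. apply Rabs_def2 in Hs'. lra. }
  rewrite (deformation_path K s), (deformation_path K t) by nra.
  apply H; lra.
Qed.

(** * The limit at time 1 and its continuity *)

Hypothesis HB : complete X.
Hypothesis HC : cerami phi.
Variable b : option R.
Hypothesis HKa : exists l : list X, forall u, m_phi phi u = 0 -> phi u = a -> In u l.
Hypothesis HKc : forall u, a < phi u -> lt_ext (phi u) b -> m_phi phi u <> 0.

Lemma deformation_limit u : a < phi u -> m_phi phi u <> 0 -> sublevel phi b u ->
  phi (deformation 1 u) = a /\ tends (iter_field u) (deformation 1 u).
Proof.
  intros Ha Hm Hb.
  destruct (trajectory_converges HB phi Hlip HC a b HKa HKc (iter_field u) (increment u)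
    (iter_field_trajectory u) Ha Hm Hb (iter_field_no_stall u)) as [z [Hz Ht]].
  replace (deformation 1 u) with z; [now split|].
  symmetry. apply deformation_eq. intros e He. destruct (Ht e He) as [N HN].
  exists N. intros n Hn. rewrite path_at_1. now apply HN.
Qed.

Lemma deformation_tends t u : a < phi u -> m_phi phi u <> 0 -> sublevel phi b u -> t <= 1 ->
  tends (fun k => path k t u) (deformation t u).
Proof.
  intros Ha Hm Hb [Ht| ->].
  - destruct (pow2_unbounded (1 - t)) as [K HK]; [lra|].
    rewrite (deformation_path K) by lra. intros e He. exists K. intros m Hm'.
    rewrite (path_stationary K m t u (progress_zero_from K t ltac:(lra) ltac:(lra)) Hm').
    rewrite vdist_refl. lra.
  - intros e He. destruct (proj2 (deformation_limit u Ha Hm Hb) e He) as [N HN].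
    exists N. intros n Hn. rewrite path_at_1. now apply HN.
Qed.

(** Passes the trap to the limit along paths; [eps / 2] pays for the approximation by a point of a
    segment of index at least [K]. *)
Lemma deformation_trapped z eps : phi z = a -> eps > 0 -> exists delta, delta > 0 /\
  forall u t K, a < phi u -> m_phi phi u <> 0 -> sublevel phi b u -> t <= 1 ->
    (forall i, (i < K)%nat -> progress i t = 1) ->
    vnorm (vsub (iter_field u K) z) < delta -> vnorm (vsub (deformation t u) z) < eps.
Proof.
  intros Hz He.
  destruct (trajectory_trapped phi Hlip HC a HKa z (eps / 2) Hz) as [delta [Hd Htrap]]; [lra|].
  exists delta. split; [assumption|]. intros u t K Ha Hm Hb Ht HK Hu.
  destruct (deformation_tends t u Ha Hm Hb Ht (eps / 2)) as [N HN]; [lra|].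
  specialize (HN (N + K)%nat ltac:(lia)). cbv beta in HN.
  destruct (path_shape K (N + K) t u Ht HK ltac:(lia)) as (j & s & Hj & Hs & Hsh).
  rewrite Hsh in HN.
  pose proof (iter_field_trajectory u) as Htr.
  pose proof (Htrap _ _ K Htr Hu (trajectory_above phi a _ _ Htr K Ha) j s Hj Hs) as Hzj.
  pose proof (vdist_triangle (deformation t u)
    (vadd (iter_field u j) (vscal s (increment u j))) z) as Htri.
  rewrite (vdist_sym (deformation t u) (vadd _ _)) in Htri. lra.
Qed.

(** Finitely many steps bring [u] into the trap of its limit. By continuity of these steps they
    bring its neighbours there too, and at times near 1 these steps are complete. *)
Lemma deformation_continuous_at_1 u eps :
  a < phi u -> m_phi phi u <> 0 -> sublevel phi b u -> eps > 0 -> exists delta, delta > 0 /\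
  forall s w, s <= 1 -> a < phi w -> m_phi phi w <> 0 -> sublevel phi b w ->
    Rabs (s - 1) < delta -> vnorm (vsub w u) < delta ->
    vnorm (vsub (deformation s w) (deformation 1 u)) < eps.
Proof.
  intros Ha Hm Hb He. destruct (deformation_limit u Ha Hm Hb) as [Hz Hlim].
  destruct (deformation_trapped _ eps Hz He) as [d [Hd Htrap]].
  destruct (Hlim (d / 2)) as [K HK]; [lra|]. specialize (HK K (le_n K)).
  destruct (iter_field_continuous K u (d / 2)) as [d' [Hd' Hc]]; [lra|].
  assert (HP : 0 < 2 ^ K) by (apply pow_lt; lra).
  (* For [1 - s < / 2 ^ K] the increments of index below [K] are complete. *)
  exists (Rmin d' (/ 2 ^ K)). split; [apply Rmin_pos; [assumption|now apply Rinv_0_lt_compat]|].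
  intros s w Hs Haw Hmw Hbw Hst Hw.
  pose proof (Rmin_l d' (/ 2 ^ K)). pose proof (Rmin_r d' (/ 2 ^ K)).
  apply (Htrap w s K); try assumption.
  - intros i Hi. apply progress_one.
    apply Rle_trans with (2 ^ K * (1 - s)); [apply pow2_mono; [lra|lia]|].
    rewrite Rabs_minus_sym, Rabs_pos_eq in Hst by lra.
    apply Rmult_le_reg_l with (/ 2 ^ K); [now apply Rinv_0_lt_compat|].
    rewrite <- Rmult_assoc, Rinv_l by lra. lra.
  - specialize (Hc w ltac:(lra)).
    pose proof (vdist_triangle (iter_field w K) (iter_field u K) (deformation 1 u)). lra.
Qed.

(** Here the starting point already lies in the trap, so [K = 0] works for all times at once; points
    at or below [a] do not move. *)
Lemma deformation_continuous_at_level z eps : phi z = a -> eps > 0 -> exists delta, delta > 0 /\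
  forall s w, s <= 1 -> (a < phi w -> m_phi phi w <> 0 /\ sublevel phi b w) ->
    vnorm (vsub w z) < delta -> vnorm (vsub (deformation s w) z) < eps.
Proof.
  intros Hz He. destruct (deformation_trapped z eps Hz He) as [d [Hd Htrap]].
  exists (Rmin d eps). split; [now apply Rmin_pos|]. intros s w Hs HS Hw.
  pose proof (Rmin_l d eps). pose proof (Rmin_r d eps).
  destruct (Rlt_le_dec a (phi w)) as [Haw|Haw].
  - destruct (HS Haw) as [Hmw Hbw]. apply (Htrap w s 0%nat); try assumption; [lia|simpl; lra].
  - rewrite deformation_below by assumption. lra.
Qed.
End Fields.

(** * Choice of descent balls and assembly of the retraction *)

Lemma descent_data_exist {X : NormedSpace} (phi : X -> R) (a : R) :
  locally_lipschitz phi -> exists (dir : X -> X) (rad : X -> R),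
    (forall p, descent_ball phi a p (dir p) (rad p) \/ rad p = 0) /\
    (forall p, a < phi p -> m_phi phi p <> 0 -> descent_ball phi a p (dir p) (rad p)).
Proof.
  intros Hlip.
  destruct (functional_choice_epsilon (fun p (s : X * R) =>
    (descent_ball phi a p (fst s) (snd s) \/ snd s = 0) /\
    (a < phi p -> m_phi phi p <> 0 -> descent_ball phi a p (fst s) (snd s)))) as [s Hs].
  - intros p. destruct (classic (a < phi p /\ m_phi phi p <> 0)) as [[Ha Hm]|Hn].
    + destruct (descent_ball_exists phi Hlip a p Ha Hm) as (v & r & H). exists (v, r). auto.
    (* A zero radius gives a bump that vanishes everywhere, so such a point never contributes to a
       field. *)
    + exists (vzero, 0). split; [now right|]. intros Ha Hm. exfalso. auto.
  - exists (fun p => fst (s p)), (fun p => snd (s p)). split; intros p; apply (Hs p).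
Qed.

Theorem theorem2p6 (X : NormedSpace) (HB : Banach X) (Hrefl : reflexive X)
  (phi : X -> R) (Hlip : locally_lipschitz phi) (HC : cerami phi)
  (a : R) (b : option R) (Hab : lt_ext a b)
  (HKa : exists l : list X, forall u, K_level phi (Some a) u -> In u l)
  (HKc : forall c, a < c -> lt_ext c b -> forall u, ~ K_level phi (Some c) u) :
  let S := fun u => sublevel phi b u /\ ~ K_level phi b u in
  exists h : R -> X -> X,
    continuous_on_IxS S h /\
    (forall t u, 0 <= t <= 1 -> S u -> S (h t u)) /\
    (forall u, S u -> h 0 u = u /\ sublevel phi (Some a) (h 1 u)) /\
    (forall t u, 0 <= t <= 1 -> sublevel phi (Some a) u -> h t u = u) /\
    (forall t u, 0 <= t <= 1 -> S u -> phi (h t u) <= phi u).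
Proof.
  intros S.
  assert (HKa' : exists l : list X, forall u, m_phi phi u = 0 -> phi u = a -> In u l).
  { destruct HKa as [l Hl]. exists l. intros u Hm Hu. apply Hl. now split. }
  assert (HKc' : forall u, a < phi u -> lt_ext (phi u) b -> m_phi phi u <> 0).
  { intros u Ha Hb Hm. apply (HKc (phi u) Ha Hb u). now split. }
  (* Levels strictly between [a] and [b] carry no critical points, and those at level [b] are
     excluded from [S]. *)
  assert (HS : forall u, S u -> a < phi u -> m_phi phi u <> 0 /\ sublevel phi b u).
  { intros u [Hb HK] Ha. split; [|assumption]. intros Hm.
    destruct (classic (lt_ext (phi u) b)) as [Hlt|Hlt]; [now apply (HKc' u)|].
    destruct b as [b'|]; simpl in *; [|tauto]. apply HK. split; [assumption|lra]. }
  destruct (well_order_exists X) as (lt & lt_total & lt_wf).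
  destruct (descent_data_exist phi a Hlip) as (dir & rad & Hball & Hgood).
  pose (h := deformation lt dir rad).
  assert (Hlim : forall u, S u -> a < phi u -> phi (h 1 u) = a).
  { intros u Su Ha. destruct (HS u Su Ha) as [Hm Hb].
    now apply (deformation_limit phi Hlip a lt lt_total lt_wf dir rad Hball Hgood
      HB HC b HKa' HKc'). }
  assert (Hbelow : forall t u, phi u <= a -> h t u = u).
  { intros t u Hu. now apply (deformation_below phi a). }
  (* Before time 1 the deformed point lies on one segment of the orbit, so finitely many descent
     steps decide both claims. *)
  assert (Hpoint : forall t u, t < 1 -> a < phi u ->
    phi (h t u) <= phi u /\ (m_phi phi u <> 0 -> m_phi phi (h t u) <> 0)).
  { intros t u Ht Ha. destruct (deformation_shape lt dir rad t u Ht) as (j & s & Hs & Heq).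
    pose proof (iter_field_trajectory phi a lt lt_total dir rad Hball u) as Htr.
    destruct (Htr j) as [Hstep _]. unfold h. rewrite Heq. split.
    - eapply Rle_trans; [apply (descent_step_le phi Hlip a); eassumption|].
      apply (trajectory_decreasing phi Hlip a _ _ Htr 0). lia.
    - intros Hm. apply (descent_step_noncritical phi Hlip a); try assumption.
      now apply (trajectory_noncritical phi Hlip a _ _ Htr). }
  assert (Hle : forall t u, 0 <= t <= 1 -> S u -> phi (h t u) <= phi u).
  { intros t u Ht Su. destruct (Rlt_le_dec a (phi u)) as [Ha|Ha].
    - destruct (proj2 Ht) as [Ht1| ->]; [now apply Hpoint|]. rewrite Hlim; [lra|easy|easy].
    - rewrite Hbelow; lra. }
  exists h. split; [|split; [|split; [|split; [|assumption]]]].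
  (* Below [a] the map is locally the identity in [u]; at level [a] the trap acts at all times;
     above [a] only time 1 needs it. *)
  - intros t u Ht Su eps He. destruct (Rtotal_order (phi u) a) as [Hu|[Hu|Hu]].
    + destruct (locally_lipschitz_continuous phi Hlip u (a - phi u)) as [d [Hd Hc]]; [lra|].
      exists (Rmin d eps). split; [now apply Rmin_pos|]. intros s w Hs Sw _ Hw.
      pose proof (Rmin_l d eps). pose proof (Rmin_r d eps).
      specialize (Hc w ltac:(lra)). apply Rabs_def2 in Hc. rewrite !Hbelow; lra.
    + destruct (deformation_continuous_at_level phi Hlip a lt lt_total lt_wf dir rad Hball Hgood
        HB HC b HKa' HKc' u eps Hu He) as [d [Hd Hc]].
      exists d. split; [assumption|]. intros s w Hs Sw _ Hw. rewrite (Hbelow t u) by lra.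
      apply Hc; [lra| |assumption]. now apply HS.
    + destruct (proj2 Ht) as [Ht1| ->].
      * destruct (deformation_continuous_before_1 phi a lt lt_total dir rad Hball
          t u eps Ht1 He) as [d [Hd Hc]].
        exists d. split; [assumption|]. intros s w Hs Sw Hst Hw. apply Hc; lra.
      * destruct (HS u Su Hu) as [Hm Hb].
        destruct (deformation_continuous_at_1 phi Hlip a lt lt_total lt_wf dir rad Hball Hgood
          HB HC b HKa' HKc' u eps Hu Hm Hb He) as [d [Hd Hc]].
        (* Keeps the neighbours above [a], where their orbits converge. *)
        destruct (locally_lipschitz_continuous phi Hlip u (phi u - a)) as [d' [Hd' Hc']]; [lra|].
        exists (Rmin d d'). split; [now apply Rmin_pos|]. intros s w Hs Sw Hst Hw.
        pose proof (Rmin_l d d'). pose proof (Rmin_r d d').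
        specialize (Hc' w ltac:(lra)). apply Rabs_def2 in Hc'.
        assert (Haw : a < phi w) by lra. destruct (HS w Sw Haw) as [Hmw Hbw].
        apply Hc; try assumption; lra.
  - intros t u Ht Su. destruct (Rlt_le_dec a (phi u)) as [Ha|Ha]; [|now rewrite Hbelow].
    destruct (HS u Su Ha) as [Hm Hb].
    destruct (proj2 Ht) as [Ht1| ->].
    + destruct (Hpoint t u Ht1 Ha) as [Hphi Hcrit]. split.
      * destruct b as [b'|]; simpl in *; [lra|trivial].
      * destruct b as [b'|]; simpl; [|tauto]. intros [Hc _]. now apply Hcrit.
    (* The endpoint has level [a < b], hence is not a critical point of level [b], even if it is
       critical. *)
    + pose proof (Hlim u Su Ha) as Hz. split; destruct b as [b'|]; simpl in *; try tauto; lra.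
  - intros u Su. split; [apply deformation_at_0|]. simpl.
    destruct (Rlt_le_dec a (phi u)) as [Ha|Ha]; [rewrite Hlim; [lra|easy|easy]|].
    now rewrite Hbelow.
  - intros t u _ Hu. now apply Hbelow.
Qed.
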